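(* Let $\mathcal M$ be an oriented matroid on a finite ground set $E$ with circuit set $\mathcal C$. Then every $\mathcal M$-separated collection has at most $|\mathrm{Ind}(\mathcal M)|$ elements, and maximal-by-size $\mathcal M$-separated collections have exactly $|\mathrm{Ind}(\mathcal M)|$ elements. Moreover, the map $\mathcal S\mapsto\sigma_{\mathcal S}$ is a bijection from the set of maximal-by-size $\mathcal M$-separated collections $\mathcal S\subseteq 2^E$ onto the set of colocalizations of $\mathcal M$ in general position (equivalently, one-element liftings of $\mathcal M$ in general position), with inverse $\sigma\mapsto\mathcal S(\sigma)$.
   Context: A signed subset of $E$ is a pair $X=(X^+,X^-)$ of disjoint subsets; its support is $\underline X=X^+\cup X^-$ and $-X=(X^-,X^+)$. An oriented matroid $\mathcal M$ on $E$ is given by its set $\mathcal C$ of signed circuits satisfying the circuit axioms (no empty circuit; $X\in\mathcal C\Rightarrow -X\in\mathcal C$; if $\underline X\subseteq\underline Y$ then $X=\pm Y$; weak elimination). A subset of $E$ is independent if it contains the support of no circuit; $\mathrm{Ind}(\mathcal M)$ is the set of independent subsets. Two subsets $I,J\subseteq E$ are $\mathcal M$-separated if there is no circuit $X$ with $X^+\subseteq I\setminus J$ and $X^-\subseteq J\setminus I$; a collection $\mathcal S\subseteq 2^E$ is $\mathcal M$-separated if any two members are $\mathcal M$-separated; it is maximal by size if its cardinality is largest among all $\mathcal M$-separated collections. A set $S\subseteq E$ orients a circuit $Y$ positively if $Y^+\subseteq S$ and $Y^-\cap S=\emptyset$, negatively if $Y^-\subseteq S$ and $Y^+\cap S=\emptyset$.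 For an $\mathcal M$-separated $\mathcal S$, $\sigma_{\mathcal S}:\mathcal C\to\{+,-,0\}$ is $+$ (resp. $-$) on $Y$ if some member of $\mathcal S$ orients $Y$ positively (resp. negatively), and $0$ otherwise. A one-element lifting of $\mathcal M$ is an oriented matroid $\widetilde{\mathcal M}$ on $E\sqcup\{g\}$ with $\widetilde{\mathcal M}/g=\mathcal M$; for each such lifting there is a unique map $\sigma:\mathcal C\to\{+,-,0\}$ (its colocalization) such that $(Y,\sigma(Y))$ is a circuit of $\widetilde{\mathcal M}$ for every $Y\in\mathcal C$, where $(Y,\sigma(Y))$ denotes $Y$ with $g$ added to $Y^+$ if $\sigma(Y)=+$, to $Y^-$ if $\sigma(Y)=-$. The lifting/colocalization is in general position if $\sigma$ takes values only in $\{+,-\}$. For a colocalization $\sigma$ in general position, $\mathcal S(\sigma)$ is the set of all $S\subseteq E$ such that every circuit $Y$ oriented positively (resp. negatively) by $S$ satisfies $\sigma(Y)=+$ (resp. $-$). *)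

(* Defs.v *)
From HB Require Import structures.
From mathcomp Require Import all_boot.
Set Implicit Arguments. Unset Strict Implicit. Unset Printing Implicit Defensive.

Inductive sign := Pos | Neg | Zero.
Definition sign_eqb (a b : sign) : bool :=
  match a, b with Pos, Pos | Neg, Neg | Zero, Zero => true | _, _ => false end.
Lemma sign_eqP : Equality.axiom sign_eqb.
Proof. by case; case; constructor. Qed.
HB.instance Definition _ := hasDecEq.Build sign sign_eqP.

(* A signed subset of T is a pair (X^+, X^-); disjointness is required
   of circuits in is_om. *)
Definition sset (T : finType) := ({set T} * {set T})%type.

Section OM.
Variable T : finType.
Implicit Types (X Y Z : sset T) (C : {set sset T}).

Definition supp X : {set T} := X.1 :|: X.2.
Definition sopp X : sset T := (X.2, X.1).

Definition is_om C : Prop :=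
  [/\ (forall X, X \in C -> X.1 :&: X.2 = set0),
      (forall X, X \in C -> supp X != set0),
      (forall X, X \in C -> sopp X \in C),
      (forall X Y, X \in C -> Y \in C -> supp X \subset supp Y ->
          X = Y \/ X = sopp Y) &
      (forall X Y e, X \in C -> Y \in C -> X <> sopp Y ->
          e \in X.1 :&: Y.2 ->
          exists2 Z, Z \in C &
            Z.1 \subset (X.1 :|: Y.1) :\ e /\ Z.2 \subset (X.2 :|: Y.2) :\ e)].

Definition Ind C : {set {set T}} :=
  [set I : {set T} | [forall X in C, ~~ (supp X \subset I)]].

Definition msep C (I J : {set T}) : bool :=
  [forall X in C, ~~ ((X.1 \subset I :\: J) && (X.2 \subset J :\: I))].

Definition sep_coll C (S : {set {set T}}) : Prop :=
  forall I J, I \in S -> J \in S -> msep C I J.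

Definition max_sep C (S : {set {set T}}) : Prop :=
  sep_coll C S /\ forall S', sep_coll C S' -> #|S'| <= #|S|.

Definition orients_pos (S : {set T}) Y : bool := (Y.1 \subset S) && [disjoint Y.2 & S].
Definition orients_neg (S : {set T}) Y : bool := (Y.2 \subset S) && [disjoint Y.1 & S].

Definition sigmaS (S : {set {set T}}) (Y : sset T) : sign :=
  if [exists S0 in S, orients_pos S0 Y] then Pos
  else if [exists S0 in S, orients_neg S0 Y] then Neg else Zero.

Definition Ssig C (sigma : sset T -> sign) : {set {set T}} :=
  [set S0 : {set T} | [forall Y in C,
     (orients_pos S0 Y ==> (sigma Y == Pos)) &&
     (orients_neg S0 Y ==> (sigma Y == Neg))]].
End OM.

(* E ⊔ {g} is modelled as option E, with g = None. *)
Section Lift.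
Variable E : finType.

Definition drop_g (X : sset (option E)) : sset E :=
  ([set e | Some e \in X.1], [set e | Some e \in X.2]).

Definition contr_g (Ct : {set sset (option E)}) : {set sset E} :=
  [set Z : sset E | [&& [exists X in Ct, Z == drop_g X], supp Z != set0 &
     [forall X in Ct, (supp (drop_g X) != set0) ==>
                       ~~ (supp (drop_g X) \proper supp Z)]]].

Definition is_lifting (C : {set sset E}) (Ct : {set sset (option E)}) : Prop :=
  is_om Ct /\ contr_g Ct = C.

Definition ext_g (Y : sset E) (s : sign) : sset (option E) :=
  ((Some @: Y.1) :|: (if s is Pos then [set None] else set0),
   (Some @: Y.2) :|: (if s is Neg then [set None] else set0)).

Definition is_coloc (C : {set sset E}) (sigma : sset E -> sign) : Prop :=
  exists Ct, is_lifting C Ct /\ forall Y, Y \in C -> ext_g Y (sigma Y) \in Ct.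

Definition gp_coloc (C : {set sset E}) (sigma : sset E -> sign) : Prop :=
  is_coloc C sigma /\ forall Y, Y \in C -> sigma Y <> Zero.
End Lift.

(* Main.v *)
Require Import Defs.
From HB Require Import structures.
From mathcomp Require Import all_boot.
Set Implicit Arguments. Unset Strict Implicit. Unset Printing Implicit Defensive.

(* A set shattered by a separated collection [S] is independent: if it contained the
   support of a circuit [X], members of [S] with traces [X.1] and [X.2] would not be
   separated.  Pajor's inequality, by which a family has at most as many members as
   shattered sets, gives the bound by [#|Ind C|].  A separated collection of that size
   is shattering-extremal, so each circuit support misses exactly one trace, and the
   signs [sigmaS S] admit elimination: circuits [X], [Y] of the same sign can be replaced
   by a circuit of that sign avoiding a given element of conflict.
   This elimination property characterizes colocalizations in general position.  It
   follows from strong elimination in the lifting.  Conversely, the circuits extended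
   by their signs, together with the conformal compositions of two circuits of opposite
   signs, satisfy weak elimination, and their conformally minimal elements are the
   circuits of a lifting.  It also implies that every independent set is strongly
   shattered by [Ssig C sigma], which therefore has at least, hence exactly, [#|Ind C|]
   members.  Taking for the sign of a circuit that of its least element shows that this
   size is attained. *)

(** * Strong elimination for signed circuits *)

Section SignedSets.
Variable T : finType.
Implicit Types (X Y Z : sset T) (C : {set sset T}).

(** Indexing by a boolean lets arguments symmetric in the two signs be made once, with [~~ b] as the
    opposite sign. *)
Definition side X (b : bool) : {set T} := if b then X.1 else X.2.

Definition conformal_le X Y : bool := [forall b, side X b \subset side Y b].

Definition elim_in X Y (e : T) Z : Prop :=
  forall c a, a \in side Z c -> a <> e /\ (a \in side X c \/ a \in side Y c).

Lemma side_sopp X b : side (sopp X) b = side X (~~ b).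
Proof. by case: b. Qed.

Lemma soppK : involutive (@sopp T).
Proof. by case. Qed.

Lemma suppP X a : reflect (exists b, a \in side X b) (a \in supp X).
Proof.
rewrite inE; apply: (iffP orP); first by case=> ?; [exists true | exists false].
by case=> -[] ?; [left | right].
Qed.

Lemma side_supp X b a : a \in side X b -> a \in supp X.
Proof. by move=> aX; apply/suppP; exists b. Qed.

Lemma supp_sopp X : supp (sopp X) = supp X.
Proof. exact: setUC. Qed.

Lemma sset_eq X Y : (forall b, side X b = side Y b) -> X = Y.
Proof.
by case: X Y => [X1 X2] [Y1 Y2] sXY; have /= -> := sXY true; have /= -> := sXY false.
Qed.

Lemma conformal_leP X Y :
  reflect (forall b a, a \in side X b -> a \in side Y b) (conformal_le X Y).
Proof.
apply: (iffP forallP) => [leXY b a | leXY b]; first exact/subsetP.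
by apply/subsetP => a; apply: leXY.
Qed.

Lemma conformal_le_supp X Y : conformal_le X Y -> supp X \subset supp Y.
Proof.
move/conformal_leP=> leXY; apply/subsetP=> a /suppP[b /leXY aY].
exact: side_supp aY.
Qed.

Lemma elim_in_supp X Y e Z :
  elim_in X Y e Z -> supp Z \subset (supp X :|: supp Y) :\ e.
Proof.
move=> elZ; apply/subsetP => a /suppP[c /elZ[/eqP ae aXY]]; rewrite in_setD1 ae in_setU.
by case: aXY => /side_supp ->; rewrite ?orbT.
Qed.

Lemma elim_in_notin X Y e Z : elim_in X Y e Z -> e \notin supp Z.
Proof. by move=> elZ; apply/suppP => -[b /elZ[]]. Qed.

Section Circuits.
Variable C : {set sset T}.
Hypothesis omC : is_om C.

Lemma circuit_disj X b a : X \in C -> a \in side X b -> a \in side X (~~ b) = false.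
Proof.
case: omC => disjC _ _ _ _ /disjC/setP/(_ a).
by rewrite !inE; case: b => /= dXa aX; move: dXa; rewrite aX ?andbT.
Qed.

Lemma circuit_sign X b c a : X \in C -> a \in side X b -> a \in side X c -> b = c.
Proof.
move=> XC aXb; case: (eqVneq b c) => // bc.
have -> : c = ~~ b by case: b c bc {aXb} => -[].
by rewrite (circuit_disj XC aXb).
Qed.

Lemma circuit_sideE X a c d : X \in C -> a \in side X c -> (a \in side X d) = (c == d).
Proof.
move=> XC aXc; have [<- //|cd] := eqVneq c d.
by apply/negbTE; apply: contraNN cd => aXd; apply/eqP; apply: circuit_sign XC aXc aXd.
Qed.

Lemma circuit_neq0 X : X \in C -> exists a, a \in supp X.
Proof. by case: omC => _ nzC _ _ _ /nzC/set0Pn. Qed.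

Lemma circuit_opp X : X \in C -> sopp X \in C.
Proof. by case: omC => _ _ oppC _ _; apply: oppC. Qed.

Lemma circuit_inc X Y :
  X \in C -> Y \in C -> supp X \subset supp Y -> X = Y \/ X = sopp Y.
Proof. by case: omC => _ _ _ incC _; apply: incC. Qed.

Lemma circuit_inc_supp X Y :
  X \in C -> Y \in C -> supp X \subset supp Y -> supp X = supp Y.
Proof. by move=> XC YC /(circuit_inc XC YC)[->|->] //; rewrite supp_sopp. Qed.

Lemma circuit_not_opp X Y b a :
  Y \in C -> a \in side X b -> a \in side Y b -> X <> sopp Y.
Proof.
by move=> YC aX aY XY; move: aX; rewrite XY side_sopp (circuit_disj YC aY).
Qed.

Lemma circuit_conformal X Y : X \in C -> Y \in C -> conformal_le X Y -> X = Y.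
Proof.
move=> XC YC leXY; case: (circuit_inc XC YC (conformal_le_supp leXY)) => // XY.
have [a /suppP[b aX]] := circuit_neq0 XC.
by case: (circuit_not_opp YC aX (conformal_leP _ _ leXY _ _ aX)).
Qed.

Lemma circuit_elim X Y b e : X \in C -> Y \in C -> X <> sopp Y ->
    e \in side X b -> e \in side Y (~~ b) ->
  exists2 Z, Z \in C & elim_in X Y e Z.
Proof.
case: (omC) => _ _ _ _ elimC.
suff elim_pos X' Y' : X' \in C -> Y' \in C -> X' <> sopp Y' ->
    e \in X'.1 -> e \in Y'.2 -> exists2 Z, Z \in C & elim_in X' Y' e Z.
  case: b => XC YC XY eX eY; first exact: elim_pos.
  have [|Z ZC elZ] := elim_pos _ _ YC XC _ eY eX.
    by move=> YX; apply: XY; rewrite YX soppK.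
  by exists Z => // c a /elZ[ae /or_comm].
move=> XC YC XY eX eY; have [|Z ZC [sZ1 sZ2]] := elimC _ _ e XC YC XY.
  by rewrite inE eX eY.
exists Z => // -[] a /=; [move/(subsetP sZ1) | move/(subsetP sZ2)];
  by rewrite !inE => /andP[/eqP ae /orP].
Qed.


(* A circuit [U] through [f] whose forbidden signs are all opposite to signs of
   an allowed circuit [Z] avoiding [f] is corrected by eliminating the forbidden
   elements one by one against [Z]. *)
Lemma elim_repair (ok : bool -> T -> Prop) (A : {set T}) Z f c U :
    (forall V a d, V \in C -> supp V \subset A -> a \in side V d ->
       a \in side Z (~~ d) -> f \in side V c ->
     exists2 W, W \in C & elim_in V Z a W /\ f \in side W c) ->
    Z \in C -> supp Z \subset A -> (forall d a, a \in side Z d -> ok d a) ->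
    U \in C -> supp U \subset A -> f \in side U c ->
    (forall d a, a \in side U d -> ok d a \/ a \in side Z (~~ d)) ->
  exists2 W, W \in C & f \in side W c /\ (forall d a, a \in side W d -> ok d a).
Proof.
move=> elimA ZC sZA okZ.
pose conf U := [set a | [exists d, (a \in side U d) && (a \in side Z (~~ d))]].
have [n] := ubnP #|conf U|; elim: n U => // n IH U ltn UC sUA fU okU.
case: (pickP (mem (conf U))) => [a aB|conf0]; last first.
  exists U => //; split=> // d a aU; case: (okU d a aU) => // aZ.
  by have := conf0 a; rewrite /= inE => /existsP[]; exists d; rewrite aU aZ.
have := aB; rewrite /= inE => /existsP[d /andP[aU aZ]].
have [W WC [elW fW]] := elimA U a d UC sUA aU aZ fU.
apply: (IH W) => //.
- rewrite ltnS in ltn; apply: leq_trans ltn; apply: proper_card.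
  apply/properP; split; last first.
    exists a; first exact: aB.
    by rewrite inE; apply/existsP => -[d' /andP[/elW[]]].
  apply/subsetP => x; rewrite !inE => /existsP[d' /andP[xW xZ]].
  apply/existsP; exists d'; rewrite xZ andbT.
  have [_ [//|xZ']] := elW _ _ xW.
  by have := circuit_disj ZC xZ'; rewrite xZ.
- apply: subset_trans (elim_in_supp elW) _; apply: subset_trans (subD1set _ _) _.
  by rewrite subUset sUA.
- move=> d' x /elW[_ [/okU//|/okZ]]; by left.
Qed.

(** As [e] lies in [X] but not in [Z], incomparability forces [Z] to leave [supp X], where it can
    only follow [Y]. *)
Lemma elim_extra X Y e Z : X \in C -> Z \in C -> e \in supp X -> elim_in X Y e Z ->
  exists d h, [/\ h \in side Z d, h \in side Y d & h \notin supp X].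
Proof.
move=> XC ZC eX elZ; have [sZX|] := boolP (supp Z \subset supp X).
  by have := elim_in_notin elZ; rewrite (circuit_inc_supp ZC XC sZX) eX.
case/subsetPn => h /suppP[d hZ] hX; exists d, h; split=> //.
by have [_ [/side_supp|//]] := elZ _ _ hZ; rewrite (negPf hX).
Qed.

(** When weak elimination loses [f], its result [Z] serves twice: its opposite turns [Y] into a
    circuit [W] having a smaller union with [X], and [Z] itself then repairs the wrong signs so
    introduced. *)
Lemma strong_elim_out X Y b e c f : X \in C -> Y \in C ->
    e \in side X b -> e \in side Y (~~ b) -> f \in side X c -> f \notin supp Y ->
  exists2 Z, Z \in C & elim_in X Y e Z /\ f \in side Z c.
Proof.
have [n] := ubnP #|supp X :|: supp Y|.
elim: n X Y b e c f => // n IH X Y b e c f; rewrite ltnS => ltn XC YC eX eY fX fY.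
have XnY : X <> sopp Y.
  by move=> XY; move: fY; rewrite -supp_sopp -XY (side_supp fX).
have small V W x : x \in supp X :|: supp Y ->
    supp V :|: supp W \subset (supp X :|: supp Y) :\ x -> #|supp V :|: supp W| < n.
  move=> xXY sVW; apply: leq_trans ltn; apply: proper_card.
  exact: sub_proper_trans sVW (properD1 xXY).
have inX x : x \in supp X -> x \in supp X :|: supp Y by rewrite in_setU => ->.
have [eXY fXY] := (inX _ (side_supp eX), inX _ (side_supp fX)).
have [Z ZC elZ] := circuit_elim XC YC XnY eX eY.
have [/suppP[c' fZ]|fZ] := boolP (f \in supp Z).
  exists Z => //; split=> //.
  have [_ [fX'|/side_supp]] := elZ _ _ fZ; last by rewrite (negPf fY).
  by rewrite (circuit_sign XC fX fX').
have [d [h [hZ hY hX]]] := elim_extra XC ZC (side_supp eX) elZ.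
have sZ := elim_in_supp elZ; have eZ := elim_in_notin elZ.
have sZ' : supp Z \subset supp X :|: supp Y := subset_trans sZ (subD1set _ _).
have oZC := circuit_opp ZC.
(* Eliminate [h] between [Y] and the opposite of [Z], keeping [e]; the union of these supports
   misses [f], so induction applies. *)
have [|||W WC [elW eW]] := IH Y (sopp Z) d h (~~ b) e _ YC oZC hY _ eY.
- apply: (small _ _ f) => //; rewrite supp_sopp.
  by rewrite subsetD1 in_setU negb_or fY fZ subUset subsetUr sZ'.
- by rewrite side_sopp negbK.
- by rewrite supp_sopp.
have sW := elim_in_supp elW; rewrite supp_sopp in sW.
have hW := elim_in_notin elW.
have sW' : supp W \subset supp X :|: supp Y.
  apply: subset_trans sW _; apply: subset_trans (subD1set _ _) _.
  by rewrite subUset subsetUr sZ'.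
(* Now eliminate [e] between [X] and [W], keeping [f]; this union misses [h]. *)
have [||U UC [elU fU]] := IH X W b e c f _ XC WC eX eW fX.
- apply: (small _ _ h); first by rewrite in_setU (side_supp hY) orbT.
  by rewrite subsetD1 in_setU negb_or hX hW subUset subsetUl sW'.
- by apply/negP => /(subsetP sW); rewrite in_setD1 in_setU (negPf fY) (negPf fZ) andbF.
have sU : supp U \subset (supp X :|: supp Y) :\ e.
  apply: subset_trans (elim_in_supp elU) _; apply: setSD.
  by rewrite subUset subsetUl.
(* The signs of [U] come from [X], [Y] or the opposite of [Z]. The last are repaired against [Z], by
   eliminations between circuits avoiding [e], which the induction covers. *)
pose ok s a := a <> e /\ (a \in side X s \/ a \in side Y s).
have [|||V VC [fV okV]] := @elim_repair ok _ Z f c U _ ZC sZ _ UC sU fU.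
- move=> V a s VC sV aV aZ fV; apply: (IH V Z s a c f) => //.
  by apply: (small _ _ e); rewrite // subUset sV sZ.
- by move=> s a /elZ.
- move=> s a /elU[ae [aX|/elW[_ [aY|]]]]; rewrite ?side_sopp; [left|left|right] => //.
    by split; [|left].
  by split; [|right].
by exists V.
Qed.

(** The remaining case has [f] in [Y] with its sign in [X]. The scheme is that of [strong_elim_out],
    but eliminating [h] between [Y] and the opposite of [Z] now keeps [f], which is possible since
    [f] is not in [Z]. *)
Lemma strong_elim X Y b e c f : X \in C -> Y \in C ->
    e \in side X b -> e \in side Y (~~ b) ->
    f \in side X c -> f \notin side Y (~~ c) ->
  exists2 Z, Z \in C & elim_in X Y e Z /\ f \in side Z c.
Proof.
move=> XC YC eX eY fX fnY.
have [/suppP[c' fY]|] := boolP (f \in supp Y); last exact: strong_elim_out eX eY fX.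
have {c' fnY}fY : f \in side Y c by case: c c' fnY fY {fX} => -[] // /negPf->.
have [n] := ubnP #|supp X :|: supp Y|.
elim: n X Y b e XC YC eX eY fX fY => // n IH X Y b e XC YC eX eY fX fY.
rewrite ltnS => ltn; have XnY := circuit_not_opp YC fX fY.
have [Z ZC elZ] := circuit_elim XC YC XnY eX eY.
have [/suppP[c' fZ]|fZ] := boolP (f \in supp Z).
  exists Z => //; split=> //; have [_ [fX'|fY']] := elZ _ _ fZ.
    by rewrite (circuit_sign XC fX fX').
  by rewrite (circuit_sign YC fY fY').
have [d [h [hZ hY hX]]] := elim_extra XC ZC (side_supp eX) elZ.
have sZ := elim_in_supp elZ; have eZ := elim_in_notin elZ.
have oZC := circuit_opp ZC.
have [||W WC [elW fW]] := strong_elim_out YC oZC hY _ fY.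
- by rewrite side_sopp negbK.
- by rewrite supp_sopp.
have sW := elim_in_supp elW; rewrite supp_sopp in sW.
have hW := elim_in_notin elW.
have sW' : supp W \subset supp X :|: supp Y.
  apply: subset_trans sW _; apply: subset_trans (subD1set _ _) _.
  by rewrite subUset subsetUr (subset_trans sZ (subD1set _ _)).
pose ok s a := a <> e /\ (a \in side X s \/ a \in side Y s).
suff [U UC [sU fU okU]] : exists2 U, U \in C &
    [/\ supp U \subset (supp X :|: supp Y) :\ e, f \in side U c &
        forall s a, a \in side U s -> ok s a \/ a \in side Z (~~ s)].
  have [||V VC [fV okV]] := @elim_repair ok _ Z f c U _ ZC sZ _ UC sU fU okU.
  - by move=> V a s VC _ aV aZ fV; apply: (strong_elim_out VC ZC aV aZ).
  - by move=> s a /elZ.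
  by exists V.
(* If [W] avoids [e] it already serves as [U]. Otherwise [e] has in [W] its sign in [Y], and
   induction eliminates it against [X] in a union that misses [h]. *)
have [/suppP[s eW]|eW] := boolP (e \in supp W); last first.
  exists W => //; split=> //; first by rewrite subsetD1 sW'.
  move=> s a aW; have [_ [aY|]] := elW _ _ aW; rewrite ?side_sopp; [left|right] => //.
  by split; [move=> ae; rewrite -ae (side_supp aW) in eW | right].
have {s}eW : e \in side W (~~ b).
  have [_ [eY'|]] := elW _ _ eW; first by rewrite (circuit_sign YC eY eY').
  by rewrite side_sopp => /side_supp; rewrite (negPf eZ).
have [|U UC [elU fU]] := IH X W b e XC WC eX eW fX fW.
  apply: leq_trans ltn; apply: proper_card; apply/properP.
  split; first by rewrite subUset subsetUl.
  exists h; first by rewrite in_setU (side_supp hY) orbT.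
  by rewrite in_setU negb_or hX.
exists U => //; split=> //.
  by apply: subset_trans (elim_in_supp elU) _; apply: setSD; rewrite subUset subsetUl.
move=> s a /elU[ae [aX|/elW[_ [aY|]]]]; rewrite ?side_sopp; [left|left|right] => //.
  by split; [|left].
by split; [|right].
Qed.

End Circuits.
End SignedSets.

(** * Shattering-extremal families *)

Section Shattering.
Variable T : finType.
Implicit Types (S : {set {set T}}) (A B F K P q : {set T}).

Definition trace S A K : bool := [exists I in S, I :&: A == K :&: A].

Definition shattered S : {set {set T}} := [set A : {set T} | [forall K : {set T}, trace S A K]].

(** These are the direction sets of the subcubes of the Boolean lattice that lie in [S]. *)
Definition strongly_shattered S : {set {set T}} :=
  [set A : {set T} | [exists K : {set T}, [forall q : {set T},
     (q \subset A) ==> ((K :\: A) :|: q \in S)]]].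

Definition half S (e : T) (b : bool) : {set {set T}} := [set I in S | (e \in I) == b].

Definition fiber S P K : {set {set T}} := [set I in S | I :&: P == K :&: P].

Lemma traceP S A K :
  reflect (exists2 I, I \in S & forall a, a \in A -> (a \in I) = (a \in K)) (trace S A K).
Proof.
apply: (iffP exists_inP) => -[I IS IK]; exists I => //.
  by move=> a aA; have /eqP/setP/(_ a) := IK; rewrite !inE aA !andbT.
apply/eqP/setP => a; rewrite !inE; have [/IK->//|] := boolP (a \in A).
by rewrite !andbF.
Qed.

Lemma shatteredP S A : reflect (forall K, trace S A K) (A \in shattered S).
Proof. by rewrite inE; apply: forallP. Qed.

Lemma sub_trace S S' A K : S \subset S' -> trace S A K -> trace S' A K.
Proof. by move=> /subsetP sSS' /exists_inP[I /sSS' IS' IK]; apply/exists_inP; exists I. Qed.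

Lemma half_sub S e b : half S e b \subset S.
Proof. by apply/subsetP => I; rewrite inE => /andP[]. Qed.

Lemma card_half S e : #|half S e true| + #|half S e false| = #|S|.
Proof.
rewrite -(cardsID [set I : {set T} | e \in I] S); congr (_ + _); apply: eq_card => I.
  by rewrite !inE eqb_id.
by rewrite !inE eqbF_neg andbC.
Qed.

Lemma shattered_half_notin S e b A : A \in shattered (half S e b) -> e \notin A.
Proof.
move/shatteredP => shA; apply/negP => eA.
case/traceP: (shA (if b then set0 else [set e])) => I.
by rewrite inE => /andP[_ /eqP eI] /(_ e eA); rewrite eI; case: (b); rewrite !inE ?eqxx.
Qed.

Lemma strongly_shattered_half_notin S e b A :
  A \in strongly_shattered (half S e b) -> e \notin A.
Proof.
rewrite inE => /existsP[K /forallP shA]; apply/negP => eA.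
case: b shA => shA; [have := shA set0 | have := shA [set e]];
  by rewrite ?sub0set ?sub1set ?eA !inE ?eqxx ?eA ?orbT ?andbF.
Qed.

Lemma card_setU1_inj e (Q : {set {set T}}) :
  (forall A, A \in Q -> e \notin A) -> #|[set e |: A | A in Q]| = #|Q|.
Proof.
move=> eQ; apply: card_in_imset => A B AQ BQ eAB.
by rewrite -(setU1K (eQ A AQ)) eAB setU1K ?eQ.
Qed.

(* With [Q1], [Q0] the sets shattered by the two halves: the shattered sets avoiding
   [e] contain [Q1 :|: Q0], those through [e] contain [e |: A] for [A] in [Q1 :&: Q0]. *)
Lemma card_shattered_half S e :
  #|shattered (half S e true)| + #|shattered (half S e false)|
    + #|[set A in shattered S | e \notin A] :\:
         (shattered (half S e true) :|: shattered (half S e false))|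
    <= #|shattered S|.
Proof.
set Q1 := shattered (half S e true); set Q0 := shattered (half S e false).
have eQ1 A : A \in Q1 -> e \notin A := @shattered_half_notin S e true A.
have eQ0 A : A \in Q0 -> e \notin A := @shattered_half_notin S e false A.
have sQS : Q1 :|: Q0 \subset [set A in shattered S | e \notin A].
  apply/subsetP => A; rewrite in_setU => AQ; rewrite inE; apply/andP; split.
    by apply/shatteredP => K; case/orP: AQ => /shatteredP/(_ K); apply: sub_trace;
      apply: half_sub.
  by case/orP: AQ => [/eQ1|/eQ0].
rewrite -cardsUI -addnA [#|Q1 :&: Q0| + _]addnC addnA.
set N := [set A in shattered S | e \notin A] in sQS *.
have -> : #|Q1 :|: Q0| + #|N :\: (Q1 :|: Q0)| = #|N|.
  by rewrite -(cardsID (Q1 :|: Q0) N) (setIidPr sQS).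
rewrite -(@card_setU1_inj e (Q1 :&: Q0)); last by move=> A /setIP[/eQ1].
rewrite -cardsUI [X in _ + X]eq_card0 ?addn0; last first.
  move=> A; rewrite !inE; apply/negP => /andP[/andP[_ /negP eA] /imsetP[B _ AB]].
  by apply: eA; rewrite AB setU11.
apply/subset_leq_card/subsetP => A; rewrite in_setU => /orP[|/imsetP[B /setIP[B1 B0] ->]].
  by rewrite inE => /andP[].
apply/shatteredP => K; have eB := eQ1 _ B1.
have [eK|eK] := boolP (e \in K).
  move/shatteredP/(_ K)/traceP: B1 => [I]; rewrite inE => /andP[IS /eqP eI] IK.
  by apply/traceP; exists I => // a; rewrite !inE => /orP[/eqP->|/IK//]; rewrite eI.
move/shatteredP/(_ K)/traceP: B0 => [I]; rewrite inE => /andP[IS /eqP eI] IK.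
apply/traceP; exists I => // a; rewrite !inE => /orP[/eqP->|/IK//].
by rewrite eI (negPf eK).
Qed.

(** A cube whose directions avoid [e] lies in one half, and a cube with direction [e] splits into
    two facets, one in each half. So the sets avoiding [e] fall in [Q1 :|: Q0], and those through
    [e] are [e |: B] with [B] in [Q1 :&: Q0]. *)
Lemma card_strongly_shattered_half S e :
  #|strongly_shattered S| <= #|strongly_shattered (half S e true)|
                             + #|strongly_shattered (half S e false)|.
Proof.
set Q1 := strongly_shattered (half S e true).
set Q0 := strongly_shattered (half S e false).
rewrite -cardsUI.
have e1 A : A \in Q1 :&: Q0 -> e \notin A.
  by move=> /setIP[/strongly_shattered_half_notin].
rewrite -(card_setU1_inj e1) -cardsUI; apply: leq_trans (leq_addr _ _).
apply/subset_leq_card/subsetP => A; rewrite inE => /existsP[K /forallP shA].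
rewrite in_setU; have [eA|eA] := boolP (e \in A).
  apply/orP; right; apply/imsetP; exists (A :\ e); last by rewrite setD1K.
  apply/setIP; split; rewrite inE; apply/existsP.
    exists (e |: K); apply/forallP => q; apply/implyP; rewrite subsetD1 => /andP[qA eq].
    rewrite inE; apply/andP; split; last by rewrite !inE eqxx.
    have := shA (e |: q); rewrite subUset sub1set eA qA.
    congr (_ \in S); apply/setP => a; rewrite !inE.
    by have [->|] := eqVneq a e; rewrite ?orbT.
  exists (K :\ e); apply/forallP => q; apply/implyP; rewrite subsetD1 => /andP[qA eq].
  rewrite inE; apply/andP; split; last by rewrite !inE eqxx (negPf eq).
  have := shA q; rewrite qA.
  congr (_ \in S); apply/setP => a; rewrite !inE.
  by have [->|] := eqVneq a e; rewrite ?eA ?orbT.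
apply/orP; left; rewrite in_setU; apply/orP.
suff {e1} : A \in strongly_shattered (half S e (e \in K)) by case: (e \in K); [left | right].
rewrite inE; apply/existsP; exists K; apply/forallP => q; apply/implyP => qA.
have := shA q; rewrite qA inE /= => ->; rewrite !inE eA /=.
by case: (boolP (e \in q)) => [/(subsetP qA)|]; rewrite ?orbF // (negPf eA).
Qed.

(** Two distinct members differ at some [e], and then both halves at [e] are proper subfamilies. *)
Lemma half_split_ind (Q : {set {set T}} -> Prop) :
    (forall S, #|S| <= 1 -> Q S) ->
    (forall S e, Q (half S e true) -> Q (half S e false) -> Q S) ->
  forall S, Q S.
Proof.
move=> Q1 Qhalf S; have [n] := ubnP #|S|; elim: n S => // n IH S; rewrite ltnS => ltn.
have [/Q1//|] := leqP #|S| 1; case/card_gt1P => I [J [IS JS IJ]].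
have [e eIJ] : exists e, (e \in I) != (e \in J).
  apply/existsP; apply: contraNT IJ; rewrite negb_exists => /forallP IJ.
  by apply/eqP/setP => e; apply/eqP; have := IJ e; rewrite negbK.
apply: (Qhalf S e); apply: IH; apply: leq_trans ltn; apply: proper_card;
  apply/properP; split; try exact: half_sub.
  case: (boolP (e \in I)) eIJ => eI; last by exists I => //; rewrite inE (negPf eI) andbF.
  by rewrite eq_sym eqb_id => /negPf eJ; exists J; rewrite // inE eJ andbF.
case: (boolP (e \in I)) eIJ => eI; first by exists I => //; rewrite inE eI andbF.
by rewrite eq_sym eqbF_neg negbK => eJ; exists J; rewrite // inE eJ andbF.
Qed.

(** Pajor's inequality: it adds up over the two halves, and a nonempty family shatters the empty
    set. *)
Lemma card_le_shattered S : #|S| <= #|shattered S|.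
Proof.
elim/half_split_ind: S => [S|S e leS1 leS0].
  have [->|[I IS] le1] := set_0Vmem S; first by rewrite cards0.
  apply: leq_trans le1 _; rewrite card_gt0; apply/set0Pn; exists set0.
  by apply/shatteredP => K; apply/traceP; exists I => // a; rewrite inE.
rewrite -(card_half S e); apply: leq_trans (card_shattered_half S e).
by apply: leq_trans (leq_addr _ _); apply: leq_add.
Qed.

(** The bound adds up over the two halves, and a family with at most one member contains no cube of
    positive dimension. *)
Lemma strongly_shattered_le_card S : #|strongly_shattered S| <= #|S|.
Proof.
elim/half_split_ind: S => [S le1|S e leS1 leS0]; last first.
  rewrite -(card_half S e); apply: leq_trans (card_strongly_shattered_half S e) _.
  exact: leq_add.
have shE A : A \in strongly_shattered S -> exists2 I, I \in S & A = set0.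
  rewrite inE => /existsP[K /forallP shA]; have := shA set0; rewrite sub0set => /= I0S.
  exists ((K :\: A) :|: set0) => //; apply/eqP; rewrite -subset0; apply/subsetP => a aA.
  have := shA A; rewrite subxx => /= I1S.
  have /setP/(_ a) := card_le1_eqP le1 _ _ I0S I1S.
  by rewrite !inE aA.
have [->|[A Ash]] := set_0Vmem (strongly_shattered S); first by rewrite cards0.
have [I IS _] := shE A Ash.
rewrite (@leq_trans 1) //; last by rewrite card_gt0; apply/set0Pn; exists I.
by apply/card_le1_eqP => B B' /shE[_ _ ->] /shE[_ _ ->].
Qed.

(** Equality in Pajor's inequality, whose other direction is [card_le_shattered]. *)
Definition extremal S : bool := #|shattered S| <= #|S|.

(** A strict Pajor inequality in one half would make the one for [S] strict. *)
Lemma extremal_half S e b : extremal S -> extremal (half S e b).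
Proof.
move=> extS; have := leq_trans (card_shattered_half S e) extS.
rewrite -(card_half S e) => /(leq_trans (leq_addr _ _)).
have := card_le_shattered (half S e true); have := card_le_shattered (half S e false).
rewrite /extremal; case: b => le0 le1.
  by rewrite leqNgt => /negP le; rewrite leqNgt; apply/negP => lt; apply: le;
    rewrite -addSn leq_add.
by rewrite leqNgt => /negP le; rewrite leqNgt; apply/negP => lt; apply: le;
    rewrite -addnS leq_add.
Qed.

(** A set shattered by neither half would count in the third term of [card_shattered_half], for
    which equality leaves no room. *)
Lemma extremal_shattered_half S e A : extremal S -> A \in shattered S -> e \notin A ->
  exists b, A \in shattered (half S e b).
Proof.
move=> extS Ash eA.
have [A1|A1] := boolP (A \in shattered (half S e true)); first by exists true.
have [A0|A0] := boolP (A \in shattered (half S e false)); first by exists false.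
have := leq_trans (card_shattered_half S e) extS; rewrite -(card_half S e).
rewrite leqNgt => /negP[]; rewrite -addn1; apply: leq_add.
  by apply: leq_add; apply: card_le_shattered.
by rewrite card_gt0; apply/set0Pn; exists A; rewrite !in_setD in_setU negb_or A1 A0 inE Ash.
Qed.

(** The elements of [P] are fixed one at a time, each time passing to a half. *)
Lemma extremal_fiber S P K : extremal S -> extremal (fiber S P K).
Proof.
have [n] := ubnP #|P|; elim: n P S => // n IH P S; rewrite ltnS => ltn extS.
have [->|[x xP]] := set_0Vmem P.
  suff -> : fiber S set0 K = S by [].
  by apply/setP => I; rewrite inE !setI0 eqxx andbT.
have -> : fiber S P K = fiber (half S x (x \in K)) (P :\ x) K.
  apply/setP => I; rewrite !inE -andbA; congr (_ && _).
  apply/eqP/andP => [IK|[/eqP xI /eqP IK]].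
    have := IK => /setP/(_ x); rewrite !inE xP !andbT => ->; rewrite eqxx; split=> //.
    apply/eqP/setP => a; have /setP/(_ a) := IK; rewrite !inE.
    by case: (a \in P); rewrite ?andbF ?andbT // => ->.
  apply/setP => a; have /setP/(_ a) := IK; rewrite !inE.
  by have [->|] := eqVneq a x; rewrite ?xI.
apply: IH; last exact: extremal_half.
by apply: leq_trans ltn; rewrite (cardsD1 x P) xP.
Qed.

(** The fiber over the trace of [K] on [P] is extremal and shatters [F], hence so does one of its
    halves at [e]: this makes [b] independent of [q]. *)
Lemma extremal_extend S P F K e : extremal S -> e \notin F ->
    (forall q, exists I, [/\ I \in S, {in P, I =i K} & {in F, I =i q}]) ->
  exists b, forall q,
    exists I, [/\ I \in S, {in P, I =i K}, {in F, I =i q} & (e \in I) = b].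
Proof.
move=> extS eF allF; have [|b /shatteredP Fb] :=
  extremal_shattered_half (extremal_fiber P K extS) _ eF.
  apply/shatteredP => q; have [I [IS IP IF]] := allF q.
  apply/traceP; exists I => //; rewrite inE IS; apply/eqP/setP => a; rewrite !inE.
  by have [/IP->|] := boolP (a \in P); rewrite ?andbF.
exists b => q; have /traceP[I] := Fb q.
rewrite !inE -andbA => /and3P[IS /eqP/setP IP /eqP eI] IF; exists I; split=> // a aP.
by have := IP a; rewrite !inE aP !andbT.
Qed.

(** Here [A] is minimal among the sets where the trace of [K] is missing. Induction on the number of
    elements of [A] where [L] differs from [K] shows every other trace present. *)
Lemma extremal_unique_missing S A K : extremal S -> ~~ trace S A K ->
    (forall a, a \in A -> trace S (A :\ a) K) ->
  forall K', ~~ trace S A K' -> {in A, K' =i K}.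
Proof.
move=> extS missK facetK K' missK' a0 a0A.
pose diff K' := [set a in A | (a \in K') != (a \in K)].
suff present L : diff L != set0 -> trace S A L.
  apply: contraNeq missK' => neK'; apply/present/set0Pn; exists a0.
  by rewrite inE a0A.
have diffP M a : a \in A -> a \notin diff M -> (a \in M) = (a \in K).
  by move=> aA; rewrite inE aA negbK => /eqP.
have [n] := ubnP #|diff L|; elim: n L => // n IH L; rewrite ltnS => ltn.
case/set0Pn => e eL; have := eL; rewrite inE => /andP[eA eK].
pose F := diff L :\ e; pose P := A :\: diff L.
have eF : e \notin F by rewrite !inE eqxx.
have inA a : a \in A -> [\/ a = e, a \in F | a \in P].
  move=> aA; rewrite !(in_setD, in_set1) aA andbT.
  by have [->|_] := eqVneq a e; [constructor 1 | case: (a \in diff L); constructor].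
have FA a : a \in F -> a \in A by rewrite !inE => /and3P[].
have PA a : a \in P -> a \in A by rewrite in_setD => /andP[].
have PL a : a \in P -> (a \in L) = (a \in K).
  by rewrite in_setD => /andP[aL aA]; apply: diffP.
(* Any values [q] on [F], with those of [K] on [P], are realized when [e] is left free: by induction
   if [q] differs from [K] on [F], by [facetK] otherwise. *)
have [q|b presb] := @extremal_extend S P F K e extS eF.
  pose M := [set a | if a \in F then a \in q else a \in K].
  have FM a : a \in F -> (a \in M) = (a \in q) by move=> aF; rewrite inE aF.
  have PM a : a \in P -> (a \in M) = (a \in K).
    move=> aP; rewrite inE (_ : a \in F = false) //.
    by move: aP; rewrite in_setD in_setD1 => /andP[/negPf-> _]; rewrite andbF.
  have sMF : diff M \subset F.
    by apply/subsetP => a; rewrite inE inE; case: ifP => //; rewrite eqxx andbF.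
  have [M0|M0] := eqVneq (diff M) set0.
    have MK a : a \in A -> (a \in M) = (a \in K).
      by move=> aA; apply: diffP; rewrite // M0 inE.
    have /traceP[I IS IK] := facetK e eA; exists I; split=> // a.
      move=> aP; apply: IK; rewrite in_setD1 PA // andbT.
      by apply: contraTneq aP => ->; rewrite in_setD eL.
    move=> aF; rewrite -FM // MK ?FA // IK // in_setD1 FA // andbT.
    by apply: contraTneq aF => ->.
  have [|//|I IS IM] := @elimT _ _ (traceP _ _ _) (IH M _ _).
    apply: leq_trans ltn; apply: leq_ltn_trans (subset_leq_card sMF) _.
    by rewrite [X in _ < X](cardsD1 e) eL.
  exists I; split=> // a; first by move=> aP; rewrite IM ?PM ?PA.
  by move=> aF; rewrite IM ?FM ?FA.
(* The common value [b] at [e] cannot be that of [K], which would realize [K]; so it is that of [L],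
   and taking [L] for [q] realizes [L]. *)
have [bK|bK] := eqVneq b (e \in K).
  have [I [IS IP IF Ie]] := presb K; case/negP: missK; apply/traceP.
  by exists I => // a /inA[->|/IF|/IP] //; rewrite Ie.
have [I [IS IP IF Ie]] := presb L; apply/traceP; exists I => // a /inA[->|/IF//|aP].
  by rewrite Ie; move: bK eK; case: b {presb Ie} (e \in K) (e \in L) => -[] [].
by rewrite IP // PL.
Qed.

End Shattering.

(** * Separated collections *)

Section Separation.
Variables (E : finType) (C : {set sset E}).
Hypothesis omC : is_om C.
Implicit Types (X Y Z : sset E) (S : {set {set E}}) (I J K A : {set E}).

Definition sgn (b : bool) : sign := if b then Pos else Neg.

Lemma sgn_inj : injective sgn.
Proof. by case=> -[]. Qed.

Definition oriented_by I X (b : bool) : Prop :=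
  forall c a, a \in side X c -> (a \in I) = (c == b).

Lemma orients_posP I X : reflect (oriented_by I X true) (orients_pos I X).
Proof.
apply: (iffP andP) => [[/subsetP sXI dXI] [] a /= aX|orX].
- exact: sXI.
- by apply/negbTE; rewrite (disjointFr dXI aX).
split; first by apply/subsetP => a aX; rewrite (orX true).
by apply/pred0P => a /=; apply/andP => -[aX]; rewrite (orX false).
Qed.

Lemma oriented_by_sopp I X b : oriented_by I (sopp X) b <-> oriented_by I X (~~ b).
Proof.
by split=> orX c a; have := orX (~~ c) a; rewrite side_sopp ?negbK => orc /orc->;
  case: b c {orX orc} => -[].
Qed.

Lemma orients_negP I X : reflect (oriented_by I X false) (orients_neg I X).
Proof.
apply: (iffP (orients_posP I (sopp X))); first by move/oriented_by_sopp.
by move=> orX; apply/oriented_by_sopp.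
Qed.

Lemma IndP A : reflect (forall X, X \in C -> ~~ (supp X \subset A)) (A \in Ind C).
Proof. by rewrite inE; apply: (iffP forall_inP). Qed.

Lemma msepP I J : reflect
  (forall X, X \in C -> oriented_by I X true -> oriented_by J X false -> False) (msep C I J).
Proof.
apply: (iffP forall_inP) => sepIJ X XC.
  move=> orI orJ; have /negP[] := sepIJ X XC; apply/andP.
  split; apply/subsetP => a aX; rewrite in_setD.
    by rewrite (orI true) ?(orJ true).
  by rewrite (orI false) ?(orJ false).
apply/negP => /andP[/subsetP sX1 /subsetP sX2]; apply: (sepIJ X XC) => -[] a /= aX.
- by have /setDP[->] := sX1 a aX.
- by have /setDP[_ /negPf->] := sX2 a aX.
- by have /setDP[_ /negPf->] := sX1 a aX.
- by have /setDP[->] := sX2 a aX.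
Qed.

Lemma sep_shattered_Ind S : sep_coll C S -> shattered S \subset Ind C.
Proof.
move=> sepS; apply/subsetP => A /shatteredP shA; apply/IndP => X XC.
apply/negP => /subsetP sXA.
have /traceP[I IS IX] := shA (side X true).
have /traceP[J JS JX] := shA (side X false).
apply: (msepP _ _ (sepS I J IS JS) X XC) => c a aX; have aA := sXA _ (side_supp aX).
  by rewrite IX // (circuit_sideE omC _ XC aX).
by rewrite JX // (circuit_sideE omC _ XC aX).
Qed.

Lemma sep_card S : sep_coll C S -> #|S| <= #|Ind C|.
Proof.
move/sep_shattered_Ind/subset_leq_card; apply: leq_trans; exact: card_le_shattered.
Qed.

Lemma SsigP sigma I : reflect
  (forall Y b, Y \in C -> oriented_by I Y b -> sigma Y = sgn b) (I \in Ssig C sigma).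
Proof.
rewrite inE; apply: (iffP forall_inP) => [sI Y b YC orY | sI Y YC].
  have /andP[/implyP pos /implyP neg] := sI Y YC.
  by case: b orY => [/orients_posP/pos/eqP|/orients_negP/neg/eqP].
by apply/andP; split; apply/implyP; [move/orients_posP | move/orients_negP] => /(sI _ _ YC) ->.
Qed.

Lemma Ssig_sep sigma : sep_coll C (Ssig C sigma).
Proof.
move=> I J /SsigP sI /SsigP sJ; apply/msepP => X XC /(sI _ _ XC) + /(sJ _ _ XC).
by move=> ->.
Qed.

(** [sigmaS] tests [Pos] first; by separation no circuit is oriented both ways, so the order of the
    tests is immaterial. *)
Lemma sigmaSP S Y b : sep_coll C S -> Y \in C ->
  sigmaS S Y = sgn b <-> exists2 I, I \in S & oriented_by I Y b.
Proof.
move=> sepS YC; rewrite /sigmaS.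
case: exists_inP => [[I IS /orients_posP orI]|nopos].
  case: b => /=; first by split=> // _; exists I.
  by split=> // -[J JS orJ]; case: (msepP _ _ (sepS I J IS JS) Y YC).
case: exists_inP => [[I IS /orients_negP orI]|noneg].
  case: b => /=; last by split=> // _; exists I.
  by split=> // -[J JS /orients_posP orJ]; case: nopos; exists J.
case: b; split=> // -[J JS]; first by move/orients_posP=> orJ; case: nopos; exists J.
by move/orients_negP=> orJ; case: noneg; exists J.
Qed.

(** The last clause is the trace on [C] of strong elimination of [e] in a lifting, keeping [g] with
    its sign [d]. *)
Definition elim_sign (sigma : sset E -> sign) : Prop :=
  [/\ (forall Y, Y \in C -> exists b, sigma Y = sgn b),
      (forall Y b, Y \in C -> sigma Y = sgn b -> sigma (sopp Y) = sgn (~~ b)) &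
      (forall X Y b d e, X \in C -> Y \in C -> sigma X = sgn d -> sigma Y = sgn d ->
         e \in side X b -> e \in side Y (~~ b) ->
       exists2 Z, Z \in C & sigma Z = sgn d /\ elim_in X Y e Z)].

(** * Signs of a separated collection of maximum size *)

Section MaximumCollection.
Variable S : {set {set E}}.
Hypotheses (sepS : sep_coll C S) (cardS : #|S| = #|Ind C|).

Lemma maximum_shattered : shattered S = Ind C.
Proof.
by apply/eqP; rewrite eqEcard sep_shattered_Ind // -cardS card_le_shattered.
Qed.

Lemma maximum_extremal : extremal S.
Proof. by rewrite /extremal maximum_shattered cardS. Qed.

Lemma sigmaS_sopp Y b : Y \in C -> sigmaS S Y = sgn b -> sigmaS S (sopp Y) = sgn (~~ b).
Proof.
move=> YC /(sigmaSP _ sepS YC)[I IS orI].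
apply/(sigmaSP _ sepS (circuit_opp omC YC)); exists I => //.
by apply/oriented_by_sopp; rewrite negbK.
Qed.

(** A minimal [B] where the trace of [K] is missing is a circuit support: it is not shattered, while
    each [B :\ a] is. Extremality makes the missing trace unique, so the opposite orientation of
    that circuit is realized in [S]. *)
Lemma maximum_missing A K : ~~ trace S A K ->
  exists Z, [/\ Z \in C, supp Z \subset A, oriented_by K Z true & sigmaS S Z = Neg].
Proof.
move=> missA; pose P B := ~~ trace S B K.
have [B /minsetP[missB minB] sBA] := @minset_exists _ P A missA.
have facet a : a \in B -> trace S (B :\ a) K.
  move=> aB; apply: contraT => missa.
  by have /setP/(_ a) := minB _ missa (subD1set _ _); rewrite in_setD1 aB eqxx.
have uniqK := extremal_unique_missing maximum_extremal missB facet.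
have : B \notin Ind C.
  by rewrite -maximum_shattered; apply: contra missB => /shatteredP.
rewrite inE negb_forall_in => /exists_inP[Z0 Z0C]; rewrite negbK => sZB.
have Z0B : supp Z0 = B.
  apply/eqP; rewrite eqEsubset sZB; apply/subsetP => a aB; apply: contraT => aZ.
  have : B :\ a \in Ind C.
    rewrite -maximum_shattered; apply/shatteredP => L.
    (* [L'] agrees with [L] off [a] and differs from [K] at [a], so its trace is not the missing
       one. *)
    pose L' := if a \in K then L :\ a else a |: L.
    have L'a : (a \in L') <> (a \in K).
      by rewrite /L'; case: ifP => aK; rewrite !inE eqxx.
    have : trace S B L' by apply: contraT => /uniqK/(_ a aB).
    case/traceP => I IS IL; apply/traceP; exists I => // x.
    rewrite in_setD1 => /andP[xa xB]; rewrite IL // /L'.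
    by case: ifP => _; rewrite !inE ?xa // (negPf xa).
  by move/IndP/(_ Z0 Z0C); rewrite subsetD1 sZB aZ.
have traceZ Z c : Z \in C -> supp Z = B -> trace S B (side Z c) ->
    exists2 I, I \in S & oriented_by I Z c.
  move=> ZC ZB /traceP[I IS IZ]; exists I => // d a aZ.
  by rewrite IZ ?(circuit_sideE omC _ ZC aZ) // -ZB (side_supp aZ).
(* Separation forbids both parts of [Z0] to be traces on [B], so the positive part of [Z0] or of its
   opposite is missing. By uniqueness it is the trace of [K], and the negative part is present. *)
suff [Z [ZC ZB missZ]] : exists Z, [/\ Z \in C, supp Z = B & ~~ trace S B (side Z true)].
  have orZ : oriented_by K Z true.
    move=> c a aZ; rewrite -(uniqK _ missZ); last by rewrite -ZB (side_supp aZ).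
    by rewrite (circuit_sideE omC _ ZC aZ).
  exists Z; split=> //; first by rewrite ZB.
  apply/(@sigmaSP S Z false) => //; apply: traceZ => //.
  have [a aZ] := circuit_neq0 omC ZC; apply: contraT => missZ'.
  have := uniqK _ missZ a; have := uniqK _ missZ' a; rewrite -ZB aZ => <- // /(_ isT).
  by case/suppP: aZ => c aZ; rewrite !(circuit_sideE omC _ ZC aZ); case: c {aZ}.
have [missZ|tr1] := boolP (~~ trace S B (side Z0 true)); first by exists Z0.
have [missZ|tr2] := boolP (~~ trace S B (side Z0 false)).
  by exists (sopp Z0); rewrite circuit_opp // supp_sopp side_sopp.
have [I IS orI] := traceZ _ _ Z0C Z0B (negbNE tr1).
have [J JS orJ] := traceZ _ _ Z0C Z0B (negbNE tr2).
by case: (msepP _ _ (sepS IS JS) Z0 Z0C).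
Qed.

(** If no circuit of sign [Neg] eliminates [e], the values of [K] on [P] are realized with all
    values on [F], and extremality gives them a common value [d] at [e]. Some member then orients
    [X] or [Y] positively, according to [d], against its sign. *)
Lemma maximum_elim_sign : elim_sign (sigmaS S).
Proof.
split; last 2 first.
- exact: sigmaS_sopp.
- suff elimNeg X Y b e : X \in C -> Y \in C -> sigmaS S X = Neg -> sigmaS S Y = Neg ->
         e \in side X b -> e \in side Y (~~ b) ->
       exists2 Z, Z \in C & sigmaS S Z = Neg /\ elim_in X Y e Z.
    move=> X Y b [] e XC YC sX sY eX eY; last exact: elimNeg sX sY eX eY.
    have [||||||Z ZC [sZ elZ]] := elimNeg (sopp X) (sopp Y) (~~ b) e;
      rewrite ?side_sopp ?negbK ?circuit_opp //.
    + exact: (sigmaS_sopp (b := true)).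
    + exact: (sigmaS_sopp (b := true)).
    exists (sopp Z); first exact: circuit_opp.
    split; first exact: (sigmaS_sopp (b := false)).
    by move=> c a; rewrite side_sopp => /elZ; rewrite !side_sopp !negbK.
  move=> XC YC sX sY eX eY.
  (* [F] collects the other conflicts of [X] and [Y], where both signs are allowed; on [P], [K]
     records the only allowed sign. *)
  pose F := [set a | (a != e) && [exists c, (a \in side X c) && (a \in side Y (~~ c))]].
  pose P := (supp X :|: supp Y) :\ e :\: F; pose K := X.1 :|: Y.1.
  have [/existsP[Z /and3P[ZC /eqP sZ /forallP elZ]]|noZ] := boolP [exists Z,
    [&& Z \in C, sigmaS S Z == Neg &
      [forall c, side Z c \subset (side X c :|: side Y c) :\ e]]].
    exists Z => //; split=> // c a aZ; have /subsetP/(_ a aZ) := elZ c.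
    by rewrite in_setD1 => /andP[/eqP ae /setUP].
  have PE a : (a \in P) = [&& a \notin F, a != e & a \in supp X :|: supp Y].
    by rewrite in_setD in_setD1.
  have eF : e \notin F by rewrite inE eqxx.
  have FE a : a \in F -> a != e /\ exists2 c, a \in side X c & a \in side Y (~~ c).
    by rewrite inE => /andP[ae /existsP[c /andP[aX aY]]]; split; last exists c.
  have [q|d presd] := extremal_extend (P := P) (K := K) maximum_extremal eF.
    pose M := [set a | if a \in F then a \in q else a \in K].
    have ME a : (a \in M) = if a \in F then a \in q else a \in K by rewrite [LHS]inE.
    have [/traceP[I IS IM]|] := boolP (trace S (P :|: F) M).
      exists I; split=> // a aPF; rewrite IM ?ME ?aPF //; last 2 first.
      - by rewrite in_setU aPF.
      - by rewrite in_setU aPF orbT.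
      by move: aPF; rewrite PE => /andP[/negPf->].
    (* A missing trace would give a circuit of sign [Neg] that avoids [e] and has only allowed
       signs. *)
    case/maximum_missing => Z [ZC sZ orZ nZ]; case/existsP: noZ; exists Z.
    rewrite ZC nZ eqxx; apply/forallP => c; apply/subsetP => a aZ.
    have := subsetP sZ a (side_supp aZ); have := orZ c a aZ; rewrite ME.
    rewrite in_setU PE in_setD1 [_ \in side X c :|: _]in_setU.
    have [/FE[-> [c' aX aY]] _ _|aF] := boolP (a \in F).
      by case: c c' aX aY {aZ} => -[] /= aX aY; rewrite ?aX ?aY ?orbT.
    rewrite orbF /= => aK /andP[->]; move: aK; rewrite !inE.
    by case: c {aZ} => /= [->|] //; case: (a \in X.1); case: (a \in Y.1).
  have conf W : W \in C -> sigmaS S W = Neg -> e \in side W d ->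
      (forall a c, a \in side W c -> a != e -> a \notin F -> a \in P /\ (a \in K) = c) ->
      False.
    move=> WC nW eW KW; have [I [IS IP IF Ie]] := presd (side W true).
    suff : sigmaS S W = Pos by rewrite nW.
    apply/(@sigmaSP S W true) => //; exists I => // c a aW.
    have [ae|ae] := eqVneq a e.
      by rewrite ae in aW *; rewrite eqb_id Ie (circuit_sign omC WC eW aW).
    have [/IF->|aF] := boolP (a \in F); first exact: (circuit_sideE omC _ WC aW).
    by have [/IP->->] := KW _ _ aW ae aF; rewrite eqb_id.
  have [db|db] := eqVneq d b.
    case: (conf X) => //; first by rewrite db.
    move=> a c aX ae aF; rewrite PE aF ae in_setU (side_supp aX); split=> //.
    rewrite in_setU -/(side X true) (circuit_sideE omC _ XC aX); case: c aX => //= aX.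
    by apply: contraNF aF => aY; rewrite inE ae; apply/existsP; exists false; rewrite aX.
  have {}db : d = ~~ b by case: d b db {presd conf eX eY} => -[].
  case: (conf Y) => //; first by rewrite db.
  move=> a c aY ae aF; rewrite PE aF ae in_setU (side_supp aY) orbT.
  split=> //; rewrite in_setU -/(side Y true) (circuit_sideE omC _ YC aY) orbC.
  case: c aY => //= aY; apply: contraNF aF => aX; rewrite inE ae.
  by apply/existsP; exists true; rewrite aY andbT.
(* The support of [Y] is dependent, so some trace on it is missing; the circuit this yields is [Y]
   or its opposite. *)
move=> Y YC; have : supp Y \notin Ind C 
  by rewrite inE negb_forall_in; apply/exists_inP; exists Y; rewrite ?negbK.
rewrite -maximum_shattered inE negb_forall => /existsP[K /maximum_missing[Z [ZC sZ _ nZ]]].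
have [<-|YZ] := circuit_inc omC ZC YC sZ; first by exists false.
exists true; rewrite -[Y]soppK -YZ; exact: (sigmaS_sopp (b := false)).
Qed.
End MaximumCollection.
End Separation.

(** * Maximum collections from signs with elimination *)

Section ElimSign.
Variables (E : finType) (C : {set sset E}).
Hypothesis omC : is_om C.
Implicit Types (X Y Z : sset E) (I J K A B : {set E}).

(** [B] is chosen one element at a time, starting from the independence of [A]. If both choices at
    [x] failed, eliminating [x] between the two offending circuits would exhibit an earlier
    failure. *)
Lemma elim_sign_avoid sigma A : elim_sign C sigma -> A \in Ind C ->
  exists B, forall Y, Y \in C -> sigma Y = Neg ->
    ~ (forall c a, a \in side Y c -> a \notin A -> (a \in B) = c).
Proof.
move=> [_ _ elimC] /IndP indA.
(* Outside [A], a bad circuit involves only the elements of [s], those already decided, and its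
   signs there follow [B]. *)
pose bad (B : {set E}) (s : seq E) Y :=
  [forall c, forall a in side Y c, (a \in A) || (a \in s) && ((a \in B) == c)].
suff [B noB] : exists B, [forall Y in C, (sigma Y == Neg) ==> ~~ bad B (enum E) Y].
  exists B => Y YC nY confY; have /forall_inP/(_ Y YC) := noB.
  rewrite nY => /negP[]; apply/forallP => c; apply/forall_inP => a aY.
  rewrite mem_enum /=; have [//|aA] := boolP (a \in A).
  by rewrite (confY c a) ?eqxx.
elim: (enum E) => [|x s [B /forall_inP noB]].
  exists set0; apply/forall_inP => Y YC; apply/implyP => _.
  apply: contra (indA Y YC) => /forallP badY; apply/subsetP => a /suppP[c aY].
  by have /forall_inP/(_ a aY) := badY c; rewrite in_nil orbF.
have [xsA|] := boolP ((x \in s) || (x \in A)).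
  exists B; apply/forall_inP => Y /noB; case: (sigma Y) => //; apply: contra.
  move=> /forallP badY; apply/forallP => c; apply/forall_inP => a /(forall_inP (badY c)).
  by rewrite in_cons; have [->|//] := eqVneq a x; case: (x \in A) xsA => //=; rewrite orbF => ->.
rewrite negb_or => /andP[xs xA].
pose B' b := if b then x |: B else B :\ x.
have B'x b : (x \in B' b) = b by case: b; rewrite !inE eqxx.
have B'a b a : a != x -> (a \in B' b) = (a \in B) by case: b => /negPf ax; rewrite !inE ax.
suff : ~~ [forall b, exists Y in C, (sigma Y == Neg) && bad (B' b) (x :: s) Y].
  rewrite negb_forall => /existsP[b]; rewrite negb_exists_in => /forall_inP noB'.
  exists (B' b); apply/forall_inP => Y YC; apply/implyP => nY.
  by have := noB' Y YC; rewrite nY.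
apply/negP => /forallP badB.
have badP b : exists Y, [/\ Y \in C, sigma Y = Neg, x \in side Y b &
    forall c a, a \in side Y c -> a != x -> (a \in A) || (a \in s) && ((a \in B) == c)].
  have /exists_inP[Y YC /andP[/eqP nY /forallP badY]] := badB b.
  have confY c a : a \in side Y c -> a != x -> (a \in A) || (a \in s) && ((a \in B) == c).
    by move=> aY ax; have /forall_inP/(_ a aY) := badY c; rewrite in_cons (negPf ax) B'a.
  exists Y; split=> //.
  have [/suppP[c xY]|xY] := boolP (x \in supp Y).
    have /forall_inP/(_ x xY) := badY c.
    by rewrite (negPf xA) in_cons eqxx B'x => /= /eqP->.
  have := noB Y YC; rewrite nY => /negP[]; apply/forallP => c; apply/forall_inP => a aY.
  by apply: confY => //; apply: contraNneq xY => <-; apply: side_supp aY.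
have [X [XC nX xX badX]] := badP true; have [Y [YC nY xY badY]] := badP false.
have [Z ZC [nZ elZ]] := elimC X Y true false x XC YC nX nY xX xY.
have := noB Z ZC; rewrite nZ => /negP[]; apply/forallP => c; apply/forall_inP => a aZ.
by have [/eqP ax [/badX|/badY]] := elZ c a aZ; apply.
Qed.

(** The cube is based at the [B] of [elim_sign_avoid], whose property depends only on values outside
    [A]. It rules out circuits of sign [Neg] oriented positively; opposites give the other
    orientation. *)
Lemma elim_sign_strongly_shattered sigma :
  elim_sign C sigma -> Ind C \subset strongly_shattered (Ssig C sigma).
Proof.
move=> elC; apply/subsetP => A indA; have [B avB] := elim_sign_avoid elC indA.
have [nzC oppC _] := elC.
rewrite inE; apply/existsP; exists B; apply/forallP => q; apply/implyP => /subsetP sqA.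
apply/SsigP => Y b YC orY.
have avoid W : W \in C -> oriented_by (B :\: A :|: q) W true -> sigma W <> Neg.
  move=> WC orW nW; apply: (avB W WC nW) => c a aW aA; have := orW c a aW.
  by rewrite !inE aA (contraNF (sqA a) aA) orbF eqb_id.
have [b' sY] := nzC Y YC; rewrite sY; congr sgn.
case: b b' sY orY => -[] // sY orY; first by case: (avoid _ YC orY).
case: (avoid (sopp Y)); first exact: circuit_opp.
  exact/oriented_by_sopp.
exact: (oppC Y true).
Qed.

Lemma elim_sign_card sigma : elim_sign C sigma -> #|Ssig C sigma| = #|Ind C|.
Proof.
move=> elC; apply/eqP; rewrite eqn_leq (sep_card omC (@Ssig_sep _ C sigma)).
apply: leq_trans (strongly_shattered_le_card _).
exact/subset_leq_card/elim_sign_strongly_shattered.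
Qed.

Definition least Y (x : E) : bool :=
  (x \in supp Y) && [forall y in supp Y, enum_rank x <= enum_rank y].

Definition lex_sign Y : sign := sgn [exists x in side Y true, least Y x].

Lemma least_exists Y : Y \in C -> exists x, least Y x.
Proof.
case/(circuit_neq0 omC) => a aY.
exists [arg min_(x < a in supp Y) enum_rank x]; case: arg_minnP => // x xY minx.
by rewrite /least xY; apply/forall_inP.
Qed.

Lemma least_uniq Y x y : least Y x -> least Y y -> x = y.
Proof.
move=> /andP[xY /forall_inP lex] /andP[yY /forall_inP ley].
by apply/enum_rank_inj/val_inj/anti_leq; rewrite lex ?ley.
Qed.

Lemma lex_signP Y x b : Y \in C -> least Y x -> lex_sign Y = sgn b <-> x \in side Y b.
Proof.
move=> YC leY; have /suppP[c xY] : x \in supp Y by case/andP: leY.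
suff -> : lex_sign Y = sgn c.
  rewrite (circuit_sideE omC b YC xY).
  by split=> [/sgn_inj->|/eqP->].
congr sgn; case: c xY => xY; first by apply/exists_inP; exists x.
apply/negbTE/exists_inP => -[y yY /(least_uniq leY) xy].
by move: yY; rewrite -xy (circuit_sideE omC _ YC xY).
Qed.

(** Strong elimination keeps the smaller [x] of the two least elements: [x] cannot have the opposite
    sign in the other circuit, where it would also be least. It stays least, as the new support lies
    in the union. *)
Lemma lex_elim_sign : elim_sign C lex_sign.
Proof.
split.
- by move=> Y YC; exists [exists x in side Y true, least Y x].
- move=> Y b YC; have [x leY] := least_exists YC => /(lex_signP b YC leY) xY.
  apply/(@lex_signP (sopp Y) x); first exact: circuit_opp.
    by rewrite /least supp_sopp.
  by rewrite side_sopp negbK.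
suff elim_le X Y b d e x y : X \in C -> Y \in C -> least X x -> least Y y ->
    enum_rank x <= enum_rank y ->
    lex_sign X = sgn d -> lex_sign Y = sgn d -> e \in side X b -> e \in side Y (~~ b) ->
  exists2 Z, Z \in C & lex_sign Z = sgn d /\ elim_in X Y e Z.
  move=> X Y b d e XC YC dX dY eX eY.
  have [[x leX] [y leY]] := (least_exists XC, least_exists YC).
  have [xy|/ltnW yx] := leqP (enum_rank x) (enum_rank y).
    exact: elim_le XC YC leX leY xy dX dY eX eY.
  have [|Z ZC [dZ elZ]] := elim_le Y X (~~ b) d e y x YC XC leY leX yx dY dX eY.
    by rewrite negbK.
  by exists Z => //; split=> // c a /elZ[ae /or_comm].
move=> XC YC leX leY xy /(lex_signP d XC leX) xX /(lex_signP d YC leY) yY eX eY.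
have /andP[_ /forall_inP minX] := leX; have /andP[_ /forall_inP minY] := leY.
have [|Z ZC [elZ xZ]] := strong_elim omC XC YC eX eY xX.
  apply/negP => xY.
  have exy : x = y by apply/enum_rank_inj/val_inj/anti_leq; rewrite xy minY ?(side_supp xY).
  by move: xY; rewrite exy (circuit_sideE omC _ YC yY); case: (d).
exists Z => //; split=> //; apply/(@lex_signP Z x) => //.
rewrite /least (side_supp xZ); apply/forall_inP => a /suppP[c /elZ[_ [/side_supp/minX //|]]].
by move/side_supp/minY; apply: leq_trans.
Qed.

Lemma max_sep_card S : max_sep C S -> sep_coll C S /\ #|S| = #|Ind C|.
Proof.
move=> [sepS maxS]; split=> //; apply/eqP; rewrite eqn_leq sep_card //.
by rewrite -(elim_sign_card lex_elim_sign) maxS //; apply: Ssig_sep.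
Qed.

Lemma elim_sign_max_sep sigma : elim_sign C sigma -> max_sep C (Ssig C sigma).
Proof.
move=> elC; split; first exact: Ssig_sep.
by move=> S /(sep_card omC); rewrite elim_sign_card.
Qed.
End ElimSign.

(** * Liftings *)

Section Lifting.
Variables (E : finType) (C : {set sset E}).
Hypothesis omC : is_om C.
Implicit Types (X Y Z : sset E).

Lemma side_drop_g (X : sset (option E)) b a : (a \in side (drop_g X) b) = (Some a \in side X b).
Proof. by case: b; rewrite inE. Qed.

Lemma supp_drop_g (X : sset (option E)) a : (a \in supp (drop_g X)) = (Some a \in supp X).
Proof. by rewrite !inE. Qed.

Lemma side_ext_g Y s b o :
  (o \in side (ext_g Y s) b) = if o is Some a then a \in side Y b else s == sgn b.
Proof.
have inSome (D : {set E}) : (o \in Some @: D) = if o is Some a then a \in D else false.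
  case: (o) => [a|]; first by rewrite mem_imset //; apply: Some_inj.
  by apply/imsetP => -[].
by case: b; case: s; rewrite !inE inSome; case: (o) => [a|]; rewrite ?inE ?orbF.
Qed.

Lemma supp_ext_g Y s o :
  (o \in supp (ext_g Y s)) = if o is Some a then a \in supp Y else s != Zero.
Proof.
rewrite in_setU -/(side _ true) -/(side _ false) !side_ext_g.
by case: o => [a|]; rewrite ?in_setU //; case: s.
Qed.

Lemma drop_ext_g Y s : drop_g (ext_g Y s) = Y.
Proof. by apply: sset_eq => b; apply/setP => a; rewrite side_drop_g side_ext_g. Qed.

Lemma sopp_ext_g Y b : sopp (ext_g Y (sgn b)) = ext_g (sopp Y) (sgn (~~ b)).
Proof. by case: b. Qed.

Lemma ext_g_inj Y Y' s s' : ext_g Y s = ext_g Y' s' -> Y = Y' /\ s = s'.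
Proof.
move=> eqYY; split; first by rewrite -(drop_ext_g Y s) eqYY drop_ext_g.
have nE b : (s == sgn b) = (s' == sgn b).
  by rewrite -(side_ext_g Y s b None) eqYY side_ext_g.
by move: (nE true) (nE false); case: s s' {eqYY nE} => -[].
Qed.

Lemma gp_coloc_sgn sigma Y : gp_coloc C sigma -> Y \in C -> exists b, sigma Y = sgn b.
Proof. by case=> _ nzC /nzC; case: (sigma Y) => // _; [exists true | exists false]. Qed.

(** The extensions of [Y] and of its opposite have the same support, hence are opposite. For
    elimination, [Some e] is eliminated in the lifting while [None] is kept. *)
Lemma gp_coloc_elim_sign sigma : gp_coloc C sigma -> elim_sign C sigma.
Proof.
move=> gpC; have sgC := gp_coloc_sgn gpC; case: gpC => -[Ct [[omCt contrC] extC]] _.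
split=> //.
  move=> Y b YC sY; have oYC := circuit_opp omC YC; have [b' sY'] := sgC _ oYC.
  have := extC _ YC; have := extC _ oYC; rewrite sY sY' => oYt Yt.
  have : supp (ext_g (sopp Y) (sgn b')) \subset supp (ext_g Y (sgn b)).
    apply/subsetP => o; rewrite !supp_ext_g; case: o => [a|_]; rewrite ?supp_sopp //.
    by case: b {sY Yt}.
  case/(circuit_inc omCt oYt Yt); last by rewrite sopp_ext_g => /ext_g_inj[_ ->].
  case/ext_g_inj => YY _; have [a /suppP[c aY]] := circuit_neq0 omC YC.
  by case: (circuit_not_opp omC YC aY aY).
move=> X Y b d e XC YC sX sY eX eY.
have Xt := extC _ XC; have Yt := extC _ YC; rewrite sX in Xt; rewrite sY in Yt.
have [||||Z Zt [elZ gZ]] := @strong_elim _ _ omCt _ _ b (Some e) d None Xt Yt.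
- by rewrite side_ext_g.
- by rewrite side_ext_g.
- by rewrite side_ext_g eqxx.
- by rewrite side_ext_g; case: (d).
(* The support of [Z] cannot reduce to [None]: it would lie properly in that of the extension of
   [X]. *)
have nZ0 : supp (drop_g Z) != set0.
  apply/negP => /eqP Z0; have : supp Z \subset supp (ext_g X (sgn d)).
    apply/subsetP => -[a|_]; last by rewrite supp_ext_g; case: (d).
    by rewrite -supp_drop_g Z0 inE.
  move/(circuit_inc_supp omCt Zt Xt)/setP/(_ (Some e)).
  by rewrite supp_ext_g -supp_drop_g Z0 inE (side_supp eX).
(* Since [Z] contains [None], a lifted circuit with a smaller trace on [E] would have its support
   properly inside that of [Z]. *)
have ZC : drop_g Z \in C.
  rewrite -contrC inE nZ0; apply/and3P; split=> //; first by apply/exists_inP; exists Z.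
  apply/forall_inP => W Wt; apply/implyP => _; apply/negP => /properP[/subsetP sWZ [a aZ aW]].
  have : supp W \subset supp Z.
    apply/subsetP => -[x|_]; last exact: side_supp gZ.
    by rewrite -!supp_drop_g; apply: sWZ.
  move/(circuit_inc_supp omCt Wt Zt)/setP/(_ (Some a)).
  by rewrite -!supp_drop_g aZ (negPf aW).
exists (drop_g Z) => //; split; last first.
  move=> c a; rewrite side_drop_g => /elZ[ae]; rewrite !side_ext_g; split=> // ae'.
  by rewrite ae' in ae.
(* [Z] and the extension of [drop_g Z] have comparable supports and agree on [E], so they coincide,
   and the sign of [drop_g Z] is read at [None]. *)
have [b' sZ] := sgC _ ZC; have := extC _ ZC; rewrite sZ => Zt'.
have : supp Z \subset supp (ext_g (drop_g Z) (sgn b')).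
  apply/subsetP => o; rewrite supp_ext_g; case: o => [a|_]; first by rewrite supp_drop_g.
  by case: (b').
case/(circuit_inc omCt Zt Zt') => eqZ.
  by move: gZ; rewrite {1}eqZ side_ext_g => /eqP.
have [a] := circuit_neq0 omC ZC; case/suppP => c aZ; have := aZ.
rewrite side_drop_g {1}eqZ side_sopp side_ext_g => aZ'.
by move: aZ'; rewrite (circuit_disj omC ZC aZ).
Qed.
End Lifting.

(** * Circuits as conformally minimal vectors *)

Section MinimalVectors.
Variables (T : finType) (V : {set sset T}).
Implicit Types (X Y Z W : sset T).
Hypothesis disjV : forall X b a, X \in V -> a \in side X b -> a \notin side X (~~ b).
Hypothesis neq0V : forall X, X \in V -> exists a, a \in supp X.
Hypothesis oppV : forall X, X \in V -> sopp X \in V.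
Hypothesis elimV : forall X Y b e, X \in V -> Y \in V -> X <> sopp Y ->
  e \in side X b -> e \in side Y (~~ b) -> exists2 Z, Z \in V & elim_in X Y e Z.

Definition minimal_vectors : {set sset T} :=
  [set X in V | [forall Y in V, conformal_le Y X ==> (Y == X)]].

Lemma minimal_vectorsP X : reflect
  (X \in V /\ forall Y, Y \in V -> conformal_le Y X -> Y = X) (X \in minimal_vectors).
Proof.
rewrite inE; apply: (iffP andP) => -[XV minX]; split=> //.
  by move=> Y YV YX; apply/eqP; have /forall_inP/(_ Y YV)/implyP := minX; apply.
by apply/forall_inP => Y YV; apply/implyP => YX; apply/eqP/minX.
Qed.

Lemma minimal_vector_below X : X \in V ->
  exists2 Y, Y \in minimal_vectors & conformal_le Y X.
Proof.
have [n] := ubnP (#|X.1| + #|X.2|); elim: n X => // n IH X; rewrite ltnS => ltn XV.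
have [minX|] := boolP [forall Y in V, conformal_le Y X ==> (Y == X)].
  by exists X; [rewrite inE XV | apply/conformal_leP].
rewrite negb_forall_in => /exists_inP[Y YV]; rewrite negb_imply => /andP[YX neYX].
have /subset_leqif_cards[le1 eq1] := forallP YX true.
have /subset_leqif_cards[le2 eq2] := forallP YX false.
have [|Z minZ ZY] := IH Y _ YV; last first.
  by exists Z => //; apply/conformal_leP => b a /(conformal_leP _ _ ZY)/(conformal_leP _ _ YX).
apply: leq_trans ltn; rewrite ltnNge; apply: contra neYX => leXY.
apply/eqP/sset_eq => -[] /=; apply/eqP; rewrite -?eq1 -?eq2 eqn_leq ?le1 ?le2 /=.
  by rewrite -(leq_add2r #|X.2|) (leq_trans leXY) // leq_add2l.
by rewrite -(leq_add2l #|X.1|) (leq_trans leXY) // leq_add2r.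
Qed.

(* Eliminating the conflicts between [X] and [W] one by one produces a vector
   strictly and conformally below [X]. *)
Lemma minimal_vector_inc X W : X \in minimal_vectors -> W \in V ->
  supp W \subset supp X -> W = X \/ W = sopp X.
Proof.
case/minimal_vectorsP=> XV minX WV sWX.
suff contra n W' : #|[set a | [exists b, (a \in side X b) && (a \in side W' (~~ b))]]| < n ->
    W' \in V -> supp W' \subset supp X -> W' <> X -> W' <> sopp X -> False.
  have [->|/eqP WX] := eqVneq W X; first by left.
  have [->|/eqP WoX] := eqVneq W (sopp X); first by right.
  by case: (contra _ W (ltnSn _)).
elim: n W' => // n IH U; rewrite ltnS => ltn UV sUX UX UoX.
set conf := [set a | _] in ltn.
have [conf0|[e e_conf]] := set_0Vmem conf.
  apply: UX; apply: minX => //; apply/conformal_leP => b a aU.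
  have /suppP[c aX] := subsetP sUX a (side_supp aU); have [<- //|cb] := eqVneq c b.
  have /setP/(_ a) := conf0; rewrite !inE => /existsP[]; exists c.
  by rewrite aX; case: b c cb aU {aX} => -[].
have := e_conf; rewrite inE => /existsP[b /andP[eX eU]].
have XoU : X <> sopp U by move=> XU; apply: UoX; rewrite XU soppK.
have [Z ZV elZ] := elimV XV UV XoU eX eU.
have eZ := elim_in_notin elZ; have eX' := side_supp eX.
apply: (IH Z) => //.
- apply: leq_trans ltn; apply: proper_card; apply/properP; split; last first.
    by exists e => //; rewrite inE; apply/existsP => -[c /andP[_ /elZ[]]].
  apply/subsetP => a; rewrite !inE => /existsP[c /andP[aX aZ]].
  apply/existsP; exists c; rewrite aX.
  by have [_ [aX'|//]] := elZ _ _ aZ; have := disjV XV aX; rewrite aX'.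
- apply: subset_trans (elim_in_supp elZ) _; apply: subset_trans (subD1set _ _) _.
  by rewrite subUset subxx.
- by move=> ZX; rewrite ZX eX' in eZ.
- by move=> ZX; rewrite ZX supp_sopp eX' in eZ.
Qed.

(** Minimality gives incomparability. For elimination, a minimal vector conformally below the result
    still avoids [e] and has only allowed signs. *)
Lemma minimal_vectors_om : is_om minimal_vectors.
Proof.
have sV X : X \in minimal_vectors -> X \in V by case/minimal_vectorsP.
split.
- move=> X /sV XV; apply/setP => a; rewrite !inE; apply/negP => /andP[a1 a2].
  by have := disjV (b := true) XV a1; rewrite /= a2.
- by move=> X /sV/neq0V[a aX]; apply/set0Pn; exists a.
- move=> X /minimal_vectorsP[XV minX]; apply/minimal_vectorsP; split; first exact: oppV.
  move=> Y YV /conformal_leP YX; rewrite -[Y]soppK; congr sopp; apply: minX; first exact: oppV.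
  by apply/conformal_leP => b a; rewrite side_sopp => /YX; rewrite side_sopp negbK.
- by move=> X Y /sV XV Ymin; apply: minimal_vector_inc.
move=> X Y e /sV XV /sV YV XY; rewrite inE => /andP[eX eY].
have [Z ZV elZ] := elimV (b := true) XV YV XY eX eY.
have [W Wmin /conformal_leP WZ] := minimal_vector_below ZV.
exists W => //; split; apply/subsetP => a aW; rewrite in_setD1 in_setU.
  by have [/eqP-> [->|->]] := elZ true a (WZ true a aW); rewrite ?orbT.
by have [/eqP-> [->|->]] := elZ false a (WZ false a aW); rewrite ?orbT.
Qed.
End MinimalVectors.

(** * A lifting built from signs with elimination *)

Section LiftingOfSign.
Variables (E : finType) (C : {set sset E}) (sigma : sset E -> sign).
Hypotheses (omC : is_om C) (elC : elim_sign C sigma).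
Implicit Types (X Y Z : sset E) (V W : sset (option E)).

Let sgC Y : Y \in C -> exists b, sigma Y = sgn b.
Proof. by case: elC => sgC _ _; apply: sgC. Qed.

Let oppC Y b : Y \in C -> sigma Y = sgn b -> sigma (sopp Y) = sgn (~~ b).
Proof. by case: elC => _ oppC _; apply: oppC. Qed.

Definition scomp X Y : sset E := (X.1 :|: Y.1, X.2 :|: Y.2).

Lemma side_scomp X Y b : side (scomp X Y) b = side X b :|: side Y b.
Proof. by case: b. Qed.

Lemma scompC X Y : scomp X Y = scomp Y X.
Proof. by apply: sset_eq => b; rewrite !side_scomp setUC. Qed.

Definition opposite_pair X Y : Prop :=
  [/\ X \in C, Y \in C, sigma X = Pos, sigma Y = Neg &
      forall b a, a \in side X b -> a \notin side Y (~~ b)].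

(* The conformal compositions of circuits with opposite values play the role of the
   vectors of the lifting that avoid [g]. *)
Definition lift_vectors : {set sset (option E)} :=
  [set ext_g Y (sigma Y) | Y in C] :|:
  [set ext_g (scomp Z.1 Z.2) Zero | Z in
    [set Z : sset E * sset E | [&& Z.1 \in C, Z.2 \in C, sigma Z.1 == Pos, sigma Z.2 == Neg &
       [forall b, [disjoint side Z.1 b & side Z.2 (~~ b)]]]]].

Lemma lift_vectorsP W : reflect
  ((exists2 Y, Y \in C & W = ext_g Y (sigma Y)) \/
   (exists X Y, opposite_pair X Y /\ W = ext_g (scomp X Y) Zero)) (W \in lift_vectors).
Proof.
rewrite in_setU; apply: (iffP orP) => -[].
- by case/imsetP => Y YC ->; left; exists Y.
- case/imsetP => -[X Y]; rewrite inE /= => /and5P[XC YC /eqP sX /eqP sY /forallP dXY] ->.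
  right; exists X, Y; split=> //; split=> // b a aX.
  by rewrite (disjointFr (dXY b) aX).
- by case=> Y YC ->; left; apply/imsetP; exists Y.
case=> X [Y [[XC YC sX sY dXY] ->]]; right; apply/imsetP; exists (X, Y) => //.
rewrite inE /= XC YC sX sY; apply/forallP => b; apply/pred0P => a /=.
by apply/negP => /andP[/dXY/negP].
Qed.

Lemma ext_g_vector Y : Y \in C -> ext_g Y (sigma Y) \in lift_vectors.
Proof. by move=> YC; apply/lift_vectorsP; left; exists Y. Qed.

(** A vector through [g] is one extended circuit, and a vector avoiding [g] has components of both
    signs. *)
Lemma vector_component W d : W \in lift_vectors -> None \notin side W (~~ d) ->
  exists2 Y, Y \in C & sigma Y = sgn d /\ forall c a, a \in side Y c -> Some a \in side W c.
Proof.
case/lift_vectorsP => [[Y YC ->]|[X [Y [[XC YC sX sY _] ->]]]].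
  have [b sY] := sgC YC; rewrite side_ext_g sY => db; exists Y => //; split.
    by rewrite sY; case: b d {sY} db => -[].
  by move=> c a; rewrite side_ext_g.
move=> _; exists (if d then X else Y); first by case: d.
split; first by case: d.
by move=> c a aY; rewrite side_ext_g side_scomp inE; case: d aY => ->; rewrite ?orbT.
Qed.

Lemma vector_component_through W c a : W \in lift_vectors -> Some a \in side W c ->
  exists2 Y, Y \in C & a \in side Y c /\ forall c' a', a' \in side Y c' -> Some a' \in side W c'.
Proof.
case/lift_vectorsP => [[Y YC ->]|[X [Y [[XC YC sX sY _] ->]]]]; rewrite side_ext_g.
  by move=> aY; exists Y => //; split=> // c' a'; rewrite side_ext_g.
rewrite side_scomp inE => /orP[aX|aY]; [exists X | exists Y] => //;
  by split=> // c' a' aZ; rewrite side_ext_g side_scomp inE aZ ?orbT.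
Qed.

(* Weak elimination between [X] and [Y] yields a circuit that can replace one of
   them, whatever its sign, and lowers the number of conflicts. *)
Lemma opposite_vector X Y d : X \in C -> Y \in C -> X <> sopp Y ->
    sigma X = sgn d -> sigma Y = sgn (~~ d) ->
  exists2 W, W \in lift_vectors & None \notin supp W /\
    forall c a, Some a \in side W c -> a \in side X c \/ a \in side Y c.
Proof.
have [n] := ubnP #|[set a | [exists b, (a \in side X b) && (a \in side Y (~~ b))]]|.
elim: n X Y d => // n IH X Y d; rewrite ltnS => ltn XC YC XY sX sY.
set conf := [set a | _] in ltn.
have [conf0|[e e_conf]] := set_0Vmem conf.
  have dXY b a : a \in side X b -> a \notin side Y (~~ b).
    move=> aX; apply/negP => aY; have /setP/(_ a) := conf0.
    by rewrite !inE => /existsP[]; exists b; rewrite aX.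
  exists (ext_g (scomp X Y) Zero).
    apply/lift_vectorsP; right; case: d sX sY => sX sY; first by exists X, Y.
    exists Y, X; split; first split=> // b a aY.
      by apply/negP => /dXY; rewrite negbK aY.
    by rewrite scompC.
  by rewrite supp_ext_g; split=> // c a; rewrite side_ext_g side_scomp => /setUP.
have := e_conf; rewrite inE => /existsP[b /andP[eX eY]].
have [Z ZC elZ] := circuit_elim omC XC YC XY eX eY; have eZ := elim_in_notin elZ.
have [d' sZ] := sgC ZC; have [dd|dd] := eqVneq d' d.
  have [||||W WV [gW WZY]] := IH Z Y d _ ZC YC => //.
  - apply: leq_trans ltn; apply: proper_card; apply/properP; split; last first.
      by exists e => //; rewrite inE; apply/existsP => -[c /andP[/elZ[]]].
    apply/subsetP => a; rewrite !inE => /existsP[c /andP[aZ aY]].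
    apply/existsP; exists c; rewrite aY andbT.
    by have [_ [//|aY']] := elZ _ _ aZ; rewrite (circuit_disj omC YC aY') in aY.
  - by move=> ZY; rewrite ZY supp_sopp (side_supp eY) in eZ.
  - by rewrite sZ dd.
  exists W => //; split=> // c a /WZY[/elZ[_ //]|]; by right.
have {}dd : d' = ~~ d by case: d d' dd {sX sY sZ} => -[].
have [||||W WV [gW WXZ]] := IH X Z d _ XC ZC => //.
- apply: leq_trans ltn; apply: proper_card; apply/properP; split; last first.
    by exists e => //; rewrite inE; apply/existsP => -[c /andP[_ /elZ[]]].
  apply/subsetP => a; rewrite !inE => /existsP[c /andP[aX aZ]].
  apply/existsP; exists c; rewrite aX.
  by have [_ [aX'|//]] := elZ _ _ aZ; rewrite (circuit_disj omC XC aX) in aX'.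
- by move=> XZ; rewrite -supp_sopp -XZ (side_supp eX) in eZ.
- by rewrite sZ dd.
by exists W => //; split=> // c a /WXZ[|/elZ[_ //]]; left.
Qed.

Lemma lift_vectors_disj W b o : W \in lift_vectors -> o \in side W b -> o \notin side W (~~ b).
Proof.
case/lift_vectorsP => [[Y YC ->]|[X [Y [[XC YC _ _ dXY] ->]]]]; rewrite !side_ext_g.
  case: o => [a aY|/eqP->]; first by rewrite (circuit_disj omC YC aY).
  by case: b.
case: o => [a|]; last by case: b.
rewrite !side_scomp !inE negb_or => /orP[aX|aY].
  by rewrite (circuit_disj omC XC aX) dXY.
rewrite (circuit_disj omC YC aY) andbT; apply/negP => /dXY.
by rewrite negbK aY.
Qed.

Lemma lift_vectors_neq0 W : W \in lift_vectors -> exists o, o \in supp W.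
Proof.
case/lift_vectorsP => [[Y YC ->]|[X [Y [[XC _ _ _ _] ->]]]].
  by have [a aY] := circuit_neq0 omC YC; exists (Some a); rewrite supp_ext_g.
have [a /suppP[b aX]] := circuit_neq0 omC XC; exists (Some a); rewrite supp_ext_g.
by apply: (@side_supp _ _ b); rewrite side_scomp inE aX.
Qed.

Lemma lift_vectors_opp W : W \in lift_vectors -> sopp W \in lift_vectors.
Proof.
case/lift_vectorsP => [[Y YC ->]|[X [Y [[XC YC sX sY dXY] ->]]]].
  have [b sY] := sgC YC; rewrite sY sopp_ext_g -(oppC YC sY).
  by apply/ext_g_vector/circuit_opp.
apply/lift_vectorsP; right; exists (sopp Y), (sopp X); split; last first.
  by rewrite scompC.
split; rewrite ?circuit_opp //; first exact: (oppC (b := false)).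
  exact: (oppC (b := true)).
by move=> b a; rewrite !side_sopp negbK => aY; apply/negP => /dXY; rewrite aY.
Qed.

Lemma vector_through_g W d : W \in lift_vectors -> None \in side W d ->
  exists2 Y, Y \in C & sigma Y = sgn d /\ W = ext_g Y (sgn d).
Proof.
case/lift_vectorsP => [[Y YC ->]|[X [Y [_ ->]]]]; rewrite side_ext_g; last by case: d.
by move/eqP=> sY; exists Y; rewrite // sY.
Qed.

(** Strong elimination in [C] between a component of [V] through [p] and one of [W] through [e]; the
    result may have either sign. *)
Lemma vector_elim_through V W b e c p : V \in lift_vectors -> W \in lift_vectors ->
    Some e \in side V b -> Some e \in side W (~~ b) ->
    Some p \in side V c -> Some p \notin side W (~~ c) ->
  exists2 Z, Z \in C & p \in side Z c /\ forall c' a, a \in side Z c' ->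
    a <> e /\ (Some a \in side V c' \/ Some a \in side W c').
Proof.
move=> VV WV eV eW pV pW.
have [X XC [pX XV]] := vector_component_through VV pV.
have [/suppP[b' eX]|eX] := boolP (e \in supp X); last first.
  exists X => //; split=> // c' a aX; split; last by left; apply: XV.
  by move=> ae; rewrite -ae (side_supp aX) in eX.
have {b'}eX : e \in side X b.
  have [<- //|bb] := eqVneq b' b; have := lift_vectors_disj VV eV.
  by rewrite (_ : ~~ b = b') ?XV //; case: b b' bb {eV eW eX} => -[].
have [Y YC [eY YW]] := vector_component_through WV eW.
have [|Z ZC [elZ pZ]] := strong_elim omC XC YC eX eY pX.
  by apply: contra pW; apply: YW.
exists Z => //; split=> // c' a /elZ[ae aXY]; split=> //.
by case: aXY => [/XV|/YW]; [left | right].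
Qed.

(** Eliminating [g] is the case of [opposite_vector]. Otherwise it suffices to extend an allowed
    circuit whose sign [g] carries in [V] or [W], or, if [g] is in neither, to compose two allowed
    circuits of opposite signs. *)
Lemma lift_vectors_elim V W b o : V \in lift_vectors -> W \in lift_vectors ->
    V <> sopp W -> o \in side V b -> o \in side W (~~ b) ->
  exists2 Z, Z \in lift_vectors & elim_in V W o Z.
Proof.
move=> VV WV VnW; case: o => [e|] oV oW; last first.
  have [X XC [sX VE]] := vector_through_g VV oV.
  have [Y YC [sY WE]] := vector_through_g WV oW.
  have XY : X <> sopp Y.
    by move=> XY; apply: VnW; rewrite VE WE sopp_ext_g negbK XY.
  have [U UV [gU UXY]] := opposite_vector XC YC XY sX sY.
  exists U => // c [a /UXY aXY|/side_supp]; last by rewrite (negPf gU).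
  by split=> //; rewrite VE WE !side_ext_g.
pose ok Z := forall c a, a \in side Z c ->
  a <> e /\ (Some a \in side V c \/ Some a \in side W c).
(* If [g] never has the sign opposite to [d], both vectors have components of sign [d], between
   which [e] can be eliminated within that sign. *)
have pick d : None \notin side V (~~ d) -> None \notin side W (~~ d) ->
    exists2 Z, Z \in C & sigma Z = sgn d /\ ok Z.
  move=> gV gW; have [X XC [sX XV]] := vector_component VV gV.
  have [Y YC [sY YW]] := vector_component WV gW.
  have [/suppP[b1 eX]|eX] := boolP (e \in supp X); last first.
    exists X => //; split=> // c a aX; split; last by left; apply: XV.
    by move=> ae; rewrite -ae (side_supp aX) in eX.
  have [/suppP[b2 eY]|eY] := boolP (e \in supp Y); last first.
    exists Y => //; split=> // c a aY; split; last by right; apply: YW.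
    by move=> ae; rewrite -ae (side_supp aY) in eY.
  have eb1 : b1 = b.
    apply/eqP; apply: contraTT (XV _ _ eX) => b1b.
    by rewrite (_ : b1 = ~~ b) ?lift_vectors_disj //; case: b b1 b1b {oV oW eX} => -[].
  have eb2 : b2 = ~~ b.
    apply/eqP; apply: contraTT (YW _ _ eY) => b2b; have := lift_vectors_disj WV oW.
    by rewrite negbK (_ : b2 = b) //; case: b b2 b2b {oV oW eY eb1} => -[].
  rewrite eb1 in eX; rewrite eb2 in eY; have [_ _ elimC] := elC.
  have [Z ZC [sZ elZ]] := elimC X Y b d e XC YC sX sY eX eY.
  exists Z => //; split=> // c a /elZ[ae aXY]; split=> //.
  by case: aXY => [/XV|/YW]; [left | right].
have lift Z d : Z \in C -> ok Z -> sigma Z = sgn d ->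
    None \in side V d \/ None \in side W d ->
    exists2 U, U \in lift_vectors & elim_in V W (Some e) U.
  move=> ZC okZ sZ gd; exists (ext_g Z (sigma Z)); first exact: ext_g_vector.
  move=> c [a|]; rewrite side_ext_g; last by rewrite sZ => /eqP/sgn_inj<-.
  by move=> /okZ[ae aVW]; split=> // -[].
have [/suppP[d gV]|gV] := boolP (None \in supp V).
  have gV' := lift_vectors_disj VV gV.
  have [gW|gW] := boolP (None \in side W (~~ d)); last first.
    by have [Z ZC [sZ okZ]] := pick d gV' gW; apply: (lift Z d) => //; left.
  (* When [g] has opposite signs in [V] and [W], either sign is allowed for it, and weak elimination
     in [C] suffices. *)
  have [X XC [sX VE]] := vector_through_g VV gV.
  have [Y YC [sY WE]] := vector_through_g WV gW.
  have XY : X <> sopp Y.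
    by move=> XY; apply: VnW; rewrite VE WE sopp_ext_g negbK XY.
  move: oV oW; rewrite VE WE !side_ext_g => eX eY.
  have [Z ZC elZ] := circuit_elim omC XC YC XY eX eY.
  have [d' sZ] := sgC ZC; rewrite -VE -WE; apply: (lift Z d') => //.
    by move=> c a /elZ[ae aXY]; split; rewrite // VE WE !side_ext_g.
  by have [->|dd] := eqVneq d' d; [left | right; case: d d' dd gW {sZ gV gV' sX sY VE WE} => -[]].
have gV' d : None \notin side V d by apply: contra gV; apply: side_supp.
have [/suppP[d gW]|gW] := boolP (None \in supp W).
  have [Z ZC [sZ okZ]] := pick d (gV' _) (lift_vectors_disj WV gW).
  by apply: (lift Z d) => //; right.
have gW' d : None \notin side W d by apply: contra gW; apply: side_supp.
have [Z1 Z1C [sZ1 ok1]] := pick true (gV' _) (gW' _).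
have [Z2 Z2C [sZ2 ok2]] := pick false (gV' _) (gW' _).
have cross X Y d : X \in C -> Y \in C -> X <> sopp Y -> sigma X = sgn d ->
    sigma Y = sgn (~~ d) -> ok X -> ok Y ->
    exists2 U, U \in lift_vectors & elim_in V W (Some e) U.
  move=> XC YC XY sX sY okX okY; have [U UV [gU UXY]] := opposite_vector XC YC XY sX sY.
  exists U => // c [a /UXY aXY|/side_supp]; last by rewrite (negPf gU).
  have [ae aVW] : a <> e /\ (Some a \in side V c \/ Some a \in side W c).
    by case: aXY => [/okX|/okY].
  by split=> // -[].
(* If [Z1] and [Z2] are opposite, they cannot be combined. An allowed circuit leaving their support
   can be combined with the one of opposite sign. *)
have [Z12|/eqP Z12] := eqVneq Z1 (sopp Z2); last exact: cross Z1C Z2C Z12 sZ1 sZ2 ok1 ok2.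
suff [Z ZC [okZ [p pZ pZ1]]] : exists2 Z, Z \in C &
    ok Z /\ exists2 p, p \in supp Z & p \notin supp Z1.
  have [[] sZ] := sgC ZC.
    apply: (cross Z Z2 true) => //; rewrite -Z12 => ZZ1.
    by rewrite -ZZ1 pZ in pZ1.
  apply: (cross Z Z1 false) => // ZZ1.
  by rewrite -supp_sopp -ZZ1 pZ in pZ1.
(* Elements of [Z1] are allowed with both signs. An element of one vector whose opposite sign is
   absent from the other is thus outside [Z1]; it exists because [V] is not the opposite of [W]. *)
have free p : p \in supp Z1 -> forall c, Some p \in side V c \/ Some p \in side W c.
  case/suppP=> c pZ1 c'; have [_ in1] := ok1 _ _ pZ1.
  have [|_ in2] := ok2 (~~ c) p; first by rewrite -side_sopp -Z12.
  by case: c c' in1 in2 {pZ1} => -[].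
case: (pickP [pred u : bool * E | (Some u.2 \in side V u.1) && (Some u.2 \notin side W (~~ u.1))]).
  move=> [c p] /= /andP[pV pW].
  have [Z ZC [pZ okZ]] := vector_elim_through VV WV oV oW pV pW.
  exists Z => //; split=> //; exists p; first exact: side_supp pZ.
  apply/negP => /free/(_ (~~ c)); rewrite (negPf pW).
  by rewrite (negPf (lift_vectors_disj VV pV)); case.
move=> noV.
case: (pickP [pred u : bool * E | (Some u.2 \in side W u.1) && (Some u.2 \notin side V (~~ u.1))]).
  move=> [c p] /= /andP[pW pV]; have oV' : Some e \in side V (~~ ~~ b) by rewrite negbK.
  have [Z ZC [pZ okZ]] := vector_elim_through WV VV oW oV' pW pV.
  exists Z => //; split; first by move=> c' a /okZ[ae /or_comm].
  exists p; first exact: side_supp pZ.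
  apply/negP => /free/(_ (~~ c)); rewrite (negPf pV).
  by rewrite (negPf (lift_vectors_disj WV pW)); case.
move=> noW; case: VnW; apply: sset_eq => c; apply/setP => -[a|]; last first.
  by rewrite (negPf (gV' _)) side_sopp (negPf (gW' _)).
rewrite side_sopp; apply/idP/idP => aU.
  by have := noV (c, a); rewrite /= aU => /negbFE.
by have := noW (~~ c, a); rewrite /= aU negbK => /negbFE.
Qed.

(** By incomparability, a composition conformally below would have both components equal to [Y], yet
    their signs differ. *)
Lemma ext_g_minimal Y : Y \in C -> ext_g Y (sigma Y) \in minimal_vectors lift_vectors.
Proof.
move=> YC; apply/minimal_vectorsP; split; first exact: ext_g_vector.
move=> W /lift_vectorsP[[X XC ->]|[X1 [X2 [[X1C X2C s1 s2 _] ->]]]] /conformal_leP leWY.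
  suff -> : X = Y by [].
  apply: (circuit_conformal omC XC YC); apply/conformal_leP => b a aX.
  by have := leWY b (Some a); rewrite !side_ext_g => ->.
have eqY X : X \in C -> (forall b, side X b \subset side (scomp X1 X2) b) -> X = Y.
  move=> XC leX; apply: (circuit_conformal omC XC YC); apply/conformal_leP => b a aX.
  by have := leWY b (Some a); rewrite !side_ext_g => -> //; apply: (subsetP (leX b)).
have X1Y : X1 = Y by apply: eqY => // b; rewrite side_scomp subsetUl.
have X2Y : X2 = Y by apply: eqY => // b; rewrite side_scomp subsetUr.
by move: s2; rewrite X2Y -X1Y s1.
Qed.

Lemma vector_supp_circuit W : W \in lift_vectors ->
  exists2 Y, Y \in C & supp Y \subset supp (drop_g W).
Proof.
case/lift_vectorsP => [[Y YC ->]|[X [Y [[XC _ _ _ _] ->]]]]; rewrite drop_ext_g.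
  by exists Y.
exists X => //; apply/subsetP => a /suppP[b aX].
by apply: (@side_supp _ _ b); rewrite side_scomp inE aX.
Qed.

(** A composition contains the support of its first component properly; otherwise the second would
    be equal or opposite to it, against their signs or their conformality. So only circuits survive
    the contraction, and all do, since every vector contains a circuit support. *)
Lemma contr_g_minimal_vectors : contr_g (minimal_vectors lift_vectors) = C.
Proof.
apply/setP => Y; rewrite inE; apply/and3P/idP => [[]|YC].
  case/exists_inP => W /minimal_vectorsP[+ _] /eqP->.
  case/lift_vectorsP => [[Z ZC ->]|[X1 [X2 [[X1C X2C s1 s2 d12] ->]]]];
    rewrite drop_ext_g // => _ /forall_inP/(_ _ (ext_g_minimal X1C)).
  rewrite drop_ext_g; case: (omC) => _ nzC _ _ _; rewrite nzC //= properE.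
  have inS X c a : (X = X1 \/ X = X2) -> a \in side X c -> a \in supp (scomp X1 X2).
    by case=> -> aX; apply: (@side_supp _ _ c); rewrite side_scomp inE aX ?orbT.
  have -> /= : supp X1 \subset supp (scomp X1 X2).
    by apply/subsetP => a /suppP[c]; apply: inS; left.
  rewrite negbK => s21; have : supp X2 \subset supp X1.
    by apply: subset_trans s21; apply/subsetP => a /suppP[c]; apply: inS; right.
  have [a /suppP[c aX2]] := circuit_neq0 omC X2C.
  case/(circuit_inc omC X2C X1C) => X21; first by move: s2; rewrite X21 s1.
  have := d12 (~~ c) a; rewrite negbK aX2; move: aX2; rewrite {1}X21 side_sopp => ->.
  by move/(_ isT).
split.
- by apply/exists_inP; exists (ext_g Y (sigma Y)); rewrite ?ext_g_minimal ?drop_ext_g.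
- by case: (omC) => _ nzC _ _ _; apply: nzC.
apply/forall_inP => W /minimal_vectorsP[/vector_supp_circuit[X XC sXW] _].
apply/implyP => _; apply/negP => /properP[sWY [a aY aW]].
have := circuit_inc_supp omC XC YC (subset_trans sXW sWY) => XY.
by rewrite (subsetP sXW) // XY in aW.
Qed.

Lemma elim_sign_gp_coloc : gp_coloc C sigma.
Proof.
split; last by move=> Y /sgC[[] ->].
exists (minimal_vectors lift_vectors); split; last by move=> Y; apply: ext_g_minimal.
split; last exact: contr_g_minimal_vectors.
apply: minimal_vectors_om.
- by move=> X b a; apply: lift_vectors_disj.
- exact: lift_vectors_neq0.
- exact: lift_vectors_opp.
exact: lift_vectors_elim.
Qed.
End LiftingOfSign.

Theorem theorem7p2 (E : finType) (C : {set sset E}) :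
  is_om C ->
  (forall S : {set {set E}}, sep_coll C S -> #|S| <= #|Ind C|) /\
  (forall S : {set {set E}}, max_sep C S -> #|S| = #|Ind C|) /\
  (forall S : {set {set E}}, max_sep C S ->
      gp_coloc C (sigmaS S) /\ Ssig C (sigmaS S) = S) /\
  (forall sigma : sset E -> sign, gp_coloc C sigma ->
      max_sep C (Ssig C sigma) /\
      (forall Y, Y \in C -> sigmaS (Ssig C sigma) Y = sigma Y)).
Proof.
move=> omC; split; first by move=> S; apply: sep_card.
split; first by move=> S /(max_sep_card omC)[].
split=> [S /(max_sep_card omC)[sepS cardS]|sigma /(gp_coloc_elim_sign omC) elC].
  have elC := maximum_elim_sign omC sepS cardS.
  split; first exact: elim_sign_gp_coloc.
  (* [S] is contained in [Ssig C (sigmaS S)], which has the same cardinality. *)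
  apply/esym/eqP; rewrite eqEcard (elim_sign_card omC elC) cardS leqnn andbT.
  apply/subsetP => I IS; apply/SsigP => Y b YC orY.
  by apply/(sigmaSP _ sepS YC); exists I.
have maxS := elim_sign_max_sep omC elC; split=> // Y YC.
have [sepS cardS] := max_sep_card omC maxS.
have [nzS _ _] := maximum_elim_sign omC sepS cardS.
(* As [sigmaS] does not vanish at [Y], a member of [Ssig C sigma] orients [Y], which forces
   [sigma Y]. *)
have [b sY] := nzS Y YC; rewrite sY; apply/esym.
by have [I /SsigP sI orI] := (sigmaSP _ sepS YC).1 sY; apply: sI.
Qed.
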